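(* Assume $\lambda>\mu(p^\star)$. For algorithm $\mathcal{A}$ with threshold $U$, choosing $\delta=\alpha\left(\frac{\log U}{U}\right)$, where $\alpha=\beta\sigma_C^2$ and $\beta\ge 2$, the profit $\mathbf{V}_{\mathcal{A}}$ of algorithm $\mathcal{A}$ satisfies $$\mathbf{V}_{\mathcal{A}}\ \ge\ \mathbf{V}_{\mathsf{OPT}}-\mathcal{O}\left(\left(\frac{\log U}{U}\right)^2\right).$$
   Context: Queueing model (discrete time). In slot $t$, $A(t)$ servers and $B(t)$ customers arrive, following i.i.d. processes with $\mathbb{E}\{A(t)\}=\lambda$ (insensitive to price) and $\mathbb{E}\{B(t)\}=\mu(p(t))$, where $p(t)$ is the price posted in slot $t$. The function $\mu(p)$ is non-increasing, continuous and concave in $p$, and $p\,\mu(p)$ is unimodal in $p$. $M(t)$ is the set of customers matched to servers (and departing) in slot $t$. With $(x)^+=\max\{0,x\}$ and an upper limit $\bar S$ on the number of waiting servers, the numbers $S(t)$ of servers and $C(t)$ of customers in the system evolve as $$S(t+1)=\min\{(S(t)+A(t)-|M(t)|)^+,\bar S\},\qquad C(t+1)=(C(t)+B(t)-|M(t)|)^+ .$$ The number $|M(t)|$ is not required to be an integer. Customer $i$ arriving at time $t$ commits to price $p_i=p(t)$, which the platform earns when that customer is matched. The profit is $$\mathbf{V}=\lim_{T\to\infty}\frac1T\sum_{t=1}^T V\Big(\sum_{i\in M(t)}p_i\Big),$$ where $V$ is a non-decreasing concave function. $\mathbf{V}_{\mathsf{OPT}}$ is the optimal value of maximizing $\mathbf{V}$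 over pricing and matching decisions $p(t),M(t)$ subject to stability of the customer queue, $\lim_{T\to\infty}\frac1T\sum_{t=1}^T\mathbb{E}\{C(t)\}<\infty$. Define $p^\star=\arg\max_{p:\ \lambda\ge\mu(p)}p\,\mu(p)$ and $N(t)=\min\{S(t),C(t)\}$. Algorithm $\mathcal{A}$ (case $\lambda>\mu(p^\star)$): it uses the constant price $p(t)=p^\star$ for all $t$, and the number of customer-server pairs matched in slot $t$, using a FIFO schedule, is $$|M_{\mathcal{A}}(t)|=\begin{cases}0&\text{if }N(t)<\mu(p^\star)-\delta,\\ \mu(p^\star)-\delta&\text{if }\mu(p^\star)-\delta\le N(t)\le U/2,\\ \mu(p^\star)+\delta&\text{if }N(t)>U/2,\end{cases}$$ where $U<\bar S$ is a threshold and $\delta>0$. $\mathbf{V}_{\mathcal{A}}$ is the profit $\mathbf{V}$ under $\mathcal{A}$. Under this constant price, $\sigma_C^2=\lim_{T\to\infty}\frac1T\mathrm{var}\left(\sum_{t=1}^T B(t)\right)$. The $\mathcal{O}(\cdot)$ is with respect to large $U$, the other parameters being fixed.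
   Formalization: V is additionally assumed twice differentiable at the point p*μ(p* ); for a merely concave V such as V(x)=min(x, p*μ(p* )) algorithm A loses order log U/U and the claimed bound fails. Prices range over an interval of nonnegative reals. *)

(* Defs.v *)
(* MathComp-Analysis development *)
From HB Require Export structures.
From mathcomp Require Export all_boot all_order all_algebra.
From mathcomp Require Export all_classical all_reals all_analysis.
Export Order.TTheory GRing.Theory Num.Theory.
Export numFieldNormedType.Exports.
Set Implicit Arguments.
Unset Strict Implicit.
Unset Printing Implicit Defensive.

Global Open Scope classical_set_scope.
Global Open Scope ring_scope.

(* A trajectory of the two-sided queue; slots are numbered from 0.
   Customers are a fluid, and all customers of a slot commit to the same price,
   so a (fractional) matching is described by the amounts
   [matched X s t] of the customers arrived in slot [s] that are matched
   in slot [t].  [history X t] is the information available at the beginning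
   of slot [t]; it may carry extra randomization. *)
Record process (R : realType) (Omega : Type) := Process {
  history : nat -> set (set Omega);
  server_arrivals : nat -> Omega -> R;
  customer_arrivals : nat -> Omega -> R;
  price : nat -> Omega -> R;
  matched : nat -> nat -> Omega -> R;
  servers : nat -> Omega -> R;
  customers : nat -> Omega -> R }.

Section Queue.
Context {R : realType}.

Definition concave_on (D : set R) (f : R -> R) : Prop :=
  convex_function (D : set (convex_lmodType R^o)) (fun x => - f x).

Definition unimodal_on (D : set R) (f : R -> R) : Prop :=
  exists m : R,
    (forall p q, D p -> D q -> p <= q -> q <= m -> f p <= f q) /\
    (forall p q, D p -> D q -> m <= p -> p <= q -> f q <= f p).

Definition twice_differentiable_at (f : R -> R) (x : R) : Prop :=
  (\forall y \near x, derivable f y 1) /\ derivable (derive1 f) x 1.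

(* [arr p] is the joint law of the numbers of servers and customers arriving in
   a slot in which the price [p] is posted; the two numbers need not be
   independent within a slot. *)
Definition arrival_model (D : set R) (lambda : R) (mu : R -> R)
    (arr : R.-pker R ~> (R * R)%type) : Prop :=
  [/\ forall p, D p -> arr p [set x | 0 <= x.1 /\ 0 <= x.2] = 1%E,
      forall p q, D p -> D q -> forall G : set R, measurable G ->
        arr p (fst @^-1` G) = arr q (fst @^-1` G),
      forall p, D p -> (\int[arr p]_x (x.1)%:E = lambda%:E)%E &
      forall p, D p -> (\int[arr p]_x (x.2)%:E = (mu p)%:E)%E].

Definition is_argmax_price (D : set R) (lambda : R) (mu : R -> R) (p : R) :=
  [/\ D p, mu p <= lambda &
      forall q, D q -> mu q <= lambda -> q * mu q <= p * mu p].

Definition pos_part (x : R) : R := Num.max 0 x.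

Definition num_matched {Omega : Type} (X : process R Omega) (t : nat)
    (w : Omega) : R :=
  \sum_(s < t.+1) matched X s t w.

Definition revenue {Omega : Type} (X : process R Omega) (t : nat)
    (w : Omega) : R :=
  \sum_(s < t.+1) price X s w * matched X s t w.

Definition num_pairs {Omega : Type} (X : process R Omega) (t : nat)
    (w : Omega) : R :=
  Num.min (servers X t w) (customers X t w).

Definition information_flow d (Omega : measurableType d)
    (F : nat -> set (set Omega)) : Prop :=
  forall t, [/\ sigma_algebra setT (F t), F t `<=` F t.+1 &
                F t `<=` measurable].

Definition known {Omega : Type} (F : set (set Omega)) (f : Omega -> R) : Prop :=
  preimage_set_system setT f measurable `<=` F.

(* Prices are posted knowing the past only; matchings are decided knowing also
   the arrivals of the current slot. *)
Definition nonanticipating d (Omega : measurableType d)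
    (X : process R Omega) : Prop :=
  information_flow (history X) /\
  forall t, [/\ known (history X t.+1) (server_arrivals X t),
                known (history X t.+1) (customer_arrivals X t),
                known (history X t) (price X t) &
                forall s, known (history X t.+1) (matched X s t)].

(* Given the past, the arrivals of slot [t] have law [arr (price X t)]; in
   particular they are i.i.d. over the slots under a constant price. *)
Definition arrivals_follow d (Omega : measurableType d)
    (P : probability Omega R) (arr : R.-pker R ~> (R * R)%type)
    (X : process R Omega) : Prop :=
  forall (t : nat) (E : set Omega) (G : set (R * R)),
    history X t E -> measurable G ->
    P (E `&` [set w | G (server_arrivals X t w, customer_arrivals X t w)]) =
    (\int[P]_(w in E) arr (price X t w) G)%E.

Definition queue_dynamics {Omega : Type} (Sbar : R) (X : process R Omega) :
    Prop :=
  forall w,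
  [/\ servers X 0%N w = 0, customers X 0%N w = 0,
      forall t, servers X t.+1 w =
        Num.min (pos_part (servers X t w + server_arrivals X t w
                           - num_matched X t w)) Sbar &
      forall t, customers X t.+1 w =
        pos_part (customers X t w + customer_arrivals X t w
                  - num_matched X t w)].

(* Every customer is matched at most once, every match uses a server present. *)
Definition feasible_matching {Omega : Type} (X : process R Omega) : Prop :=
  forall w,
  [/\ forall s t, 0 <= matched X s t w,
      forall s T, \sum_(s <= t < T) matched X s t w <= customer_arrivals X s w &
      forall t, num_matched X t w <= servers X t w + server_arrivals X t w].

Definition admissible d (Omega : measurableType d) (P : probability Omega R)
    (D : set R) (arr : R.-pker R ~> (R * R)%type) (Sbar : R)
    (X : process R Omega) : Prop :=
  [/\ nonanticipating X, arrivals_follow P arr X,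
      forall t w, [/\ D (price X t w), 0 <= server_arrivals X t w
                    & 0 <= customer_arrivals X t w],
      queue_dynamics Sbar X & feasible_matching X].

Definition stable d (Omega : measurableType d) (P : probability Omega R)
    (X : process R Omega) : Prop :=
  (limn_esup (fun T : nat =>
     (T%:R^-1)%:E * \sum_(0 <= t < T) 'E_P[customers X t]) < +oo)%E.

(* Sample-path profit; the lower limit makes it total and is the limit whenever
   the latter exists. *)
Definition profit {Omega : Type} (V : R -> R) (X : process R Omega)
    (w : Omega) : \bar R :=
  limn_einf (fun T : nat =>
    (T%:R^-1 * \sum_(0 <= t < T) V (revenue X t w))%:E).

(* The expectation only matters for policies whose sample-path profit is not
   almost surely constant.  The supremum also ranges over the probability
   spaces carrying the process. *)
Definition optimal_profit (D : set R) (arr : R.-pker R ~> (R * R)%type)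
    (Sbar : R) (V : R -> R) : \bar R :=
  ereal_sup [set v | exists (d : measure_display) (Omega : measurableType d)
      (P : probability Omega R) (X : process R Omega),
      [/\ admissible P D arr Sbar X, stable P X &
          v = (\int[P]_w profit V X w)%E]].

(* Customers of a slot are served only after all those of earlier slots. *)
Definition fifo {Omega : Type} (X : process R Omega) : Prop :=
  forall (r s t : nat) (w : Omega), (r < s <= t)%N -> 0 < matched X s t w ->
    \sum_(r <= u < t.+1) matched X r u w = customer_arrivals X r w.

Definition runs_algorithm {Omega : Type} (pstar m delta U : R)
    (X : process R Omega) : Prop :=
  [/\ forall t w, price X t w = pstar,
      forall t w, num_matched X t w =
        if num_pairs X t w < m - delta then 0
        else if num_pairs X t w <= U / 2 then m - delta
        else m + delta &
      fifo X].

Definition customer_variance_rate d (Omega : measurableType d)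
    (P : probability Omega R) (X : process R Omega) (sigma2 : R) : Prop :=
  ((T%:R^-1)%:E *
    variance P (fun w => (\sum_(0 <= t < T) customer_arrivals X t w)%R))%E
  @[T --> \oo] --> sigma2%:E.

End Queue.

(* Main.v *)
Require Import Defs.
From mathcomp Require Import measurable_realfun ring lra zify.
Set Implicit Arguments.
Unset Strict Implicit.
Unset Printing Implicit Defensive.

(** Write [m] for [mu pstar].  The optimal profit and the profit of the
    algorithm are both compared with [V (pstar * m)].

    The optimal profit is at most [V (pstar * m)].  As [mu] is nonincreasing and
    concave, the revenue rate [p * mu p] is concave, and as [mu pstar < lambda]
    the price [pstar] maximizes it over all of [D]
    ([revenue_rate_le_argmax]).  Given the past, the customers of a slot commit
    to an expected payment [p * mu p <= pstar * m], and a policy collects no more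
    than what has been committed.  Replacing [V] by its tangent at
    [pstar * m] and applying Fatou's lemma gives the bound
    ([optimal_profit_le]).

    The algorithm loses [O (delta ^+ 2)] and little else.  In a slot with
    service the revenue is [pstar * (m - delta)] or [pstar * (m + delta)], so
    that [V] of it agrees with the tangent up to [O (delta ^+ 2)], which is
    [O ((ln U / U) ^+ 2)].  There remain the linear term, a multiple of the
    difference between [m] and the mean number of matches per slot, and the
    slots without service.  In these there are fewer than [m - delta] customers
    (a short queue), or else at most [U / 2] servers (a starved slot).

    While servers are not starved, a queue above [U / 2] is served at a rate
    above [m], so the throughput falls short of [m] only by the frequency of
    starved slots ([throughput]).  It is thus enough to bound two frequencies by
    [O ((ln U / U) ^+ 2)], and an exponential potential does it for both.
    The servers have a positive drift, bounded away from [0], up to a cap above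
    [U]; hence starved slots are exponentially rare in [U]
    ([starved_slots_le]).  The customers have the drift [delta] below [U / 2].
    With the exponent [delta / sigma2], the potential [expR (- (th * C t))] does
    not grow in mean below [U / 2]; above [U / 2] its growth is at most
    [O (th * delta)] times [U] to the power [- beta / 2], whereas a slot with a
    short queue makes it lose a quantity of order [th].  This gives the
    frequency [O (delta / U)] for short queues ([short_queue_slots_le]).  Only
    the lower tail of the arrivals enters, and so a second moment of the
    arrivals suffices; it is recovered from the variance rate
    ([customer_second_moment]).

    These balances hold along each sample path up to a sum of bounded
    increments with mean [0] given the past, and this sum is almost surely
    [o(T)] ([strong_law_innovations]). *)

(** * Real-variable estimates *)

Section Analysis.
Context {R : realType}.
Implicit Types (x y a b : R).

(** The square of [exp (x / 2) <= (1 - x / 2)^-1], which is sharp to first order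
    and stays below the quadratic up to [x = (3 - sqrt 5) / 2]. It is the
    coefficient [1] of [x ^+ 2] that later lets the exponent [delta / sigma2]
    work exactly. *)
Lemma expR_le_quadratic x : x <= 3^-1 -> expR x <= 1 + x + x ^+ 2.
Proof.
move=> x3.
have h0 : 0 < 1 - x / 2 by lra.
have h1 : expR (- (x / 2)) >= 1 - x / 2 by have := expR_ge1Dx (- (x / 2)); lra.
have h2 : expR x * expR (- (x / 2)) ^+ 2 = 1.
  by rewrite expr2 -!expRD -[RHS]expR0; congr expR; lra.
have h3 : expR x * (1 - x / 2) ^+ 2 <= 1.
  by rewrite -[leRHS]h2 ler_wpM2l ?expR_ge0// ler_pXn2r ?nnegrE ?expR_ge0 ?(ltW h0).
have h4 : 1 <= (1 + x + x ^+ 2) * (1 - x / 2) ^+ 2.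
  have h5 : 0 <= 1 - 3 * x + x ^+ 2 by nra.
  have -> : (1 + x + x ^+ 2) * (1 - x / 2) ^+ 2
    = 1 + (x / 2) ^+ 2 * (1 - 3 * x + x ^+ 2) by field.
  by rewrite lerDl mulr_ge0// sqr_ge0.
rewrite -(ler_pM2r (_ : 0 < (1 - x / 2) ^+ 2)) ?exprn_gt0//.
exact: le_trans h3 h4.
Qed.

Lemma concave_onP (D : set R) (f : R -> R) t x y : concave_on D f ->
  D x -> D y -> 0 <= t <= 1 ->
  t * f x + (1 - t) * f y <= f (t * x + (1 - t) * y).
Proof.
move=> cf Dx Dy /andP[t0 t1].
have := cf (Itv01 t0 t1) x y; rewrite !inE => /(_ Dx Dy).
rewrite /conv/= /conv/= /unstable.onem /GRing.scale/=; lra.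
Qed.

Lemma derivable_first_order (f : R -> R) x : derivable f x 1 ->
  forall e, 0 < e -> exists2 d, 0 < d &
    forall h, `|h| < d -> `|f (x + h) - f x - derive1 f x * h| <= e * `|h|.
Proof.
move=> df e e0; have := derivable_nbhs df => /eqaddoP /(_ e e0).
move=> /nbhs_ballP[d /= d0 hd]; exists d => // h hdlt.
have := hd h; rewrite /ball/= sub0r normrN => /(_ hdlt).
rewrite /= opprD -![(_ + _ : _ -> _) _]/(_ + _) -![(- _ : _ -> _) _]/(- _) /=.
rewrite derive1E addrA [h *: 1]mulr1 [h *: _]mulrC (addrC h x).
by [].
Qed.

Lemma small_step d y : 0 < d -> exists2 t : R, 0 < t <= 1 & `|t * y| < d.
Proof.
move=> d0; have n0 : 0 < `|y| + 1 by rewrite ltr_wpDl.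
exists (Num.min 1 (d / (2 * (`|y| + 1)))).
  by rewrite lt_min ltr01 ge_min lexx divr_gt0// mulr_gt0.
set t := Num.min _ _.
have t0 : 0 < t by rewrite lt_min ltr01 divr_gt0// mulr_gt0.
rewrite normrM (gtr0_norm t0); apply: (@le_lt_trans _ _ (d / 2)); last by lra.
apply: (@le_trans _ _ (d / (2 * (`|y| + 1)) * (`|y| + 1))).
  by apply: ler_pM => //; [exact: ltW|rewrite ge_min lexx orbT|lra].
by rewrite invfM mulrA mulfVK// gt_eqF.
Qed.

(** The slope of the chord from [x0] to [x0 + t * (y - x0)] decreases in [t] by
    concavity, and tends to the derivative as [t] tends to [0]. The statement
    includes [x0 = 0], where concavity is available on one side only. *)
Lemma concave_tangent (V : R -> R) x0 y :
  concave_on [set x | 0 <= x] V -> 0 <= x0 -> derivable V x0 1 -> 0 <= y ->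
  V y <= V x0 + derive1 V x0 * (y - x0).
Proof.
move=> cV x00 dV y0; rewrite -lerBlDl; apply/ler_addgt0Pr => e e0.
have ye : 0 < e / (`|y - x0| + 1) by rewrite divr_gt0// ltr_wpDl.
have [d d0 hd] := derivable_first_order dV ye.
have n0 : 0 < `|y - x0| + 1 by rewrite ltr_wpDl.
have [t /andP[t0 t1] td] := small_step (y - x0) d0.
have := hd _ td; rewrite ler_norml => /andP[_ h1].
have : t * V y + (1 - t) * V x0 <= V (t * y + (1 - t) * x0).
  by apply: concave_onP cV _ _ _ => //; rewrite ltW.
have -> : t * y + (1 - t) * x0 = x0 + t * (y - x0) by ring.
move=> h2; rewrite normrM (gtr0_norm t0) in h1.
have h3 : t * (V y - V x0)
    <= t * (derive1 V x0 * (y - x0) + e / (`|y - x0| + 1) * `|y - x0|).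
  lra.
move: h3; rewrite ler_pM2l// => h3; apply: (le_trans h3).
rewrite lerD2l -mulrA ger_pMr// ler_pdivrMl// mulr1; lra.
Qed.

(** By the mean value theorem the increment of [V] is [V' z * h] with [z]
    between [x0] and [x0 + h], and [V' z] is within [L * |h|] of [V' x0] because
    [V'] is differentiable at the one point [x0]. *)
Lemma twice_differentiable_second_order (V : R -> R) x0 :
  twice_differentiable_at V x0 -> exists L d, [/\ 0 <= L, 0 < d &
    forall h, `|h| < d -> `|V (x0 + h) - V x0 - derive1 V x0 * h| <= L * h ^+ 2].
Proof.
move=> [near1 dd]; have [d1 d10 hd1] := derivable_first_order dd ltr01.
move/nbhs_ballP: near1 => [d2 /= d20 hd2].
exists (`|derive1 (derive1 V) x0| + 1), (Num.min d1 d2); split.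
- by rewrite addr_ge0.
- by rewrite lt_min d10.
move=> h; rewrite lt_min => /andP[hh1 hh2].
have key z : `|z| <= `|h| -> `|derive1 V (x0 + z) - derive1 V x0|
    <= (`|derive1 (derive1 V) x0| + 1) * `|h|.
  move=> zh; have := hd1 z (le_lt_trans zh hh1); rewrite mul1r => h1.
  rewrite -[X in `|X|](subrK (derive1 (derive1 V) x0 * z)).
  apply: (le_trans (ler_normD _ _)); rewrite normrM.
  rewrite mulrDl mul1r addrC; apply: lerD; first exact: ler_wpM2l.
  exact: le_trans h1 zh.
have dV z : `|z| <= `|h| -> derivable V (x0 + z) 1.
  move=> zh; apply: hd2; rewrite /ball/= opprD addNKr normrN.
  exact: le_lt_trans zh hh2.
have isd z : `|z - x0| <= `|h| -> is_derive z 1 V (derive1 V z).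
  move=> zh; rewrite derive1E; apply/derivableP.
  by have := dV _ zh; rewrite (_ : x0 + (z - x0) = z)//; ring.
have cts a b : (forall z, z \in `[a, b] -> `|z - x0| <= `|h|) ->
    {within `[a, b], continuous V}.
  move=> H; apply: derivable_within_continuous => z zab.
  by have [] := isd z (H _ zab).
have [h0|h0|->] := ltgtP h 0; last 1 first.
- by rewrite addr0 subrr mulr0 subr0 normr0 expr0n mulr0.
- have H z : z \in `[x0 + h, x0] -> `|z - x0| <= `|h|.
    by rewrite in_itv/= => /andP[? ?]; rewrite ler0_norm ?(ltr0_norm h0); lra.
  have [//||//|c cab E] := @MVT R V (derive1 V) (x0 + h) x0.
  + by lra.
  + by move=> z zab; apply/isd/H/subset_itv_oo_cc.
  + exact: cts.
  have /key := H _ (subset_itv_oo_cc cab).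
  rewrite (_ : x0 + (c - x0) = c) => [k1|]; last by ring.
  have -> : V (x0 + h) - V x0 - derive1 V x0 * h = (derive1 V c - derive1 V x0) * h.
    have -> : V (x0 + h) - V x0 = - (V x0 - V (x0 + h)) by ring.
    by rewrite E; ring.
  by rewrite normrM -(real_normK (num_real h)) expr2 mulrA ler_wpM2r.
- have H z : z \in `[x0, x0 + h] -> `|z - x0| <= `|h|.
    by rewrite in_itv/= => /andP[? ?]; rewrite ger0_norm ?(gtr0_norm h0); lra.
  have [//||//|c cab E] := @MVT R V (derive1 V) x0 (x0 + h).
  + by lra.
  + by move=> z zab; apply/isd/H/subset_itv_oo_cc.
  + exact: cts.
  have /key := H _ (subset_itv_oo_cc cab).
  rewrite (_ : x0 + (c - x0) = c) => [k1|]; last by ring.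
  have -> : V (x0 + h) - V x0 - derive1 V x0 * h = (derive1 V c - derive1 V x0) * h.
    by rewrite E; ring.
  by rewrite normrM -(real_normK (num_real h)) expr2 mulrA ler_wpM2r.
Qed.

Lemma derive1_ge0_right (V : R -> R) x0 : (forall x y, 0 <= x -> x <= y -> V x <= V y) ->
  0 <= x0 -> derivable V x0 1 -> 0 <= derive1 V x0.
Proof.
move=> Vnd x00 dV; rewrite leNgt; apply/negP => an.
have e0 : 0 < - derive1 V x0 / 2 by lra.
have [d d0 /(_ (d / 2))] := derivable_first_order dV e0.
rewrite ger0_norm; last by lra.
move=> /(_ ltac:(lra)); rewrite ler_norml => /andP[_ h1].
have := Vnd x0 (x0 + d / 2) x00 ltac:(lra); nra.
Qed.

(** For nonnegative prices and a nonincreasing concave [mu], the revenue rate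
    [p * mu p] is itself concave: the defect of the chord is [t * (1 - t)] times
    [(q - pstar) * (mu q - mu pstar) <= 0]. Since the constraint
    [mu p <= lambda] is slack at [pstar], [pstar] is a local maximum, hence a
    global one. *)
Lemma revenue_rate_le_argmax (D : set R) (lambda : R) (mu : R -> R) pstar :
  is_interval D -> (forall p, D p -> 0 <= p) ->
  (forall p q, D p -> D q -> p <= q -> mu q <= mu p) ->
  {within D, continuous mu} -> concave_on D mu ->
  is_argmax_price D lambda mu pstar -> mu pstar < lambda ->
  forall q, D q -> q * mu q <= pstar * mu pstar.
Proof.
move=> Ditv D0 mun muc mucc [Dp _ pmax] lam q Dq.
have := muc => /subspace_continuousP/(_ _ Dp)/cvgrPdist_lt.
move=> /(_ (lambda - mu pstar)); rewrite subr_gt0 => /(_ lam).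
rewrite near_withinE => /nbhs_ballP[d /= d0 hd].
have [t /andP[t0 t1] td] := small_step (q - pstar) d0.
pose r := t * q + (1 - t) * pstar.
have rE : r = pstar + t * (q - pstar) by rewrite /r; ring.
have Dr : D r.
  have [pq|qp] := leP pstar q.
    have h1 : 0 <= t * (q - pstar) by rewrite mulr_ge0 ?subr_ge0// ltW.
    have h2 : 0 <= (1 - t) * (q - pstar) by rewrite mulr_ge0 ?subr_ge0.
    by apply: (Ditv pstar q) => //; apply/andP; split; rewrite /r; lra.
  have h1 : 0 <= t * (pstar - q) by rewrite mulr_ge0 ?subr_ge0// ltW.
  have h2 : 0 <= (1 - t) * (pstar - q) by rewrite mulr_ge0 ?subr_ge0// ltW.
  by apply: (Ditv q pstar) => //; apply/andP; split; rewrite /r; lra.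
have mur : mu r <= lambda.
  have := hd r; rewrite /ball/= rE opprD addNKr normrN => /(_ td).
  rewrite -rE => /(_ Dr); rewrite /from_subspace distrC ltr_norml => /andP[_]; lra.
have h1 := pmax _ Dr mur.
have h2 : t * mu q + (1 - t) * mu pstar <= mu r.
  by apply: concave_onP mucc _ _ _ => //; rewrite ltW.
have h3 : r * (t * mu q + (1 - t) * mu pstar) <= r * mu r.
  exact: ler_wpM2l (D0 _ Dr) _ _ h2.
have h4 : (q - pstar) * (mu q - mu pstar) <= 0.
  have [pq|qp] := leP pstar q.
    by have := mun _ _ Dp Dq pq; nra.
  by have := mun _ _ Dq Dp (ltW qp); nra.
have h5 : r * (t * mu q + (1 - t) * mu pstar) = t * (q * mu q)
   + (1 - t) * (pstar * mu pstar) - t * (1 - t) * ((q - pstar) * (mu q - mu pstar)).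
  by rewrite /r; ring.
have h6 : t * (1 - t) * ((q - pstar) * (mu q - mu pstar)) <= 0.
  by rewrite mulr_ge0_le0// mulr_ge0 ?(ltW t0)// subr_ge0.
have : t * (q * mu q) <= t * (pstar * mu pstar) by lra.
by rewrite ler_pM2l.
Qed.

(** From [ln U = 2 * ln (sqrt U) <= 2 * sqrt U]. *)
Lemma ln_div_small (e : R) : 0 < e -> exists2 U0 : R, 4 <= U0 &
  forall U, U0 <= U -> 1 <= ln U /\ ln U / U <= e.
Proof.
move=> e0; exists (4 + (2 / e) ^+ 2); first by rewrite lerDl sqr_ge0.
move=> U hU.
have U3 : 4 <= U by apply: le_trans hU; rewrite lerDl sqr_ge0.
have U0 : 0 < U by lra.
split.
  rewrite -ler_expR lnK ?posrE//; apply: le_trans U3.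
  have := @expR_le_quadratic 3^-1 (lexx _).
  have -> : expR 1 = expR 3^-1 ^+ 3 :> R.
    by rewrite !exprS expr0 mulr1 -!expRD; congr expR; lra.
  move=> h; apply: (@le_trans _ _ ((1 + 3^-1 + 3^-1 ^+ 2) ^+ 3)); last by lra.
  by rewrite ler_pXn2r// nnegrE; [exact: expR_ge0|lra].
have s0 : 0 < Num.sqrt U by rewrite sqrtr_gt0.
have sU : Num.sqrt U ^+ 2 = U by rewrite sqr_sqrtr// ltW.
have lns : ln U <= 2 * Num.sqrt U.
  rewrite -[X in ln X]sU lnXn// mulr2n.
  have := @le_ln1Dx R (Num.sqrt U - 1); rewrite addrCA subrr addr0.
  by move=> /(_ ltac:(lra)); lra.
rewrite ler_pdivrMr//; apply: (le_trans lns).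
have : 2 / e <= Num.sqrt U.
  have h : (2 / e) ^+ 2 <= Num.sqrt U ^+ 2 by rewrite sU; lra.
  by rewrite -(@ler_pXn2r _ 2)// nnegrE ?divr_ge0 ?sqrtr_ge0 ?ltW.
rewrite ler_pdivrMr// => h; rewrite -[in leRHS]sU; nra.
Qed.

End Analysis.

(** * Conditioning on the past *)

Section GraphKernel.
Context d1 d2 d3 (T : measurableType d1) (S : measurableType d2)
  (Y : measurableType d3) (R : realType).
Variables (k : R.-pker S ~> Y) (p : T -> S).

Definition reindexed (mp : measurable_fun setT p) (x : T) :
  {measure set Y -> \bar R} := k (p x).

(** The law of [(x, y)] with [y] drawn from [k (p x)]. The [unit] factor is the
    parameter required by the composition of kernels. *)
Definition graph_kernel (mp : measurable_fun setT p) (ux : unit * T) :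
    {measure set (T * Y) -> \bar R} :=
  measure_function_pushforward__canonical__measure_function_Measure
    (reindexed mp ux.2) (pair1_measurable ux.2).

Hypothesis mp : measurable_fun setT p.

Let measurable_reindexed U : measurable U ->
  measurable_fun [set: T] (reindexed mp ^~ U).
Proof.
move=> mU; exact: (measurableT_comp (measurable_kernel k U mU) mp).
Qed.

HB.instance Definition _ :=
  isKernel.Build _ _ _ _ _ (reindexed mp) measurable_reindexed.

HB.instance Definition _ := Kernel_isProbability.Build _ _ _ _ _ (reindexed mp)
  (fun x => prob_kernel (p x)).

Let graph_kernelE ux U :
  graph_kernel mp ux U = reindexed mp ux.2 (xsection U ux.2).
Proof. by rewrite /graph_kernel/= /pushforward xsectionE. Qed.

Let measurable_graph U : measurable U ->
  measurable_fun [set: unit * T] (graph_kernel mp ^~ U).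
Proof.
move=> mU; under eq_fun do rewrite graph_kernelE.
apply: (@measurableT_comp _ _ _ _ _ _ (fun x => reindexed mp x (xsection U x)) _ snd).
  by apply: measurable_fun_xsection_finite_kernel; rewrite inE.
exact: measurable_snd.
Qed.

HB.instance Definition _ :=
  isKernel.Build _ _ _ _ _ (graph_kernel mp) measurable_graph.

Let graph_prob ux : graph_kernel mp ux setT = 1%E.
Proof. by rewrite graph_kernelE xsectionE preimage_setT; exact: prob_kernel. Qed.

HB.instance Definition _ := Kernel_isProbability.Build _ _ _ _ _ (graph_kernel mp)
  graph_prob.

End GraphKernel.

Section Disintegration.
Local Open Scope ereal_scope.
Context d d2 d3 (Omega : measurableType d) (S : measurableType d2)
  (Y : measurableType d3) (R : realType).
Variables (P : probability Omega R) (F : set (set Omega)).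
Hypotheses (sF : sigma_algebra setT F) (FM : F `<=` measurable).
Notation T := (g_sigma_algebraType F).

Lemma measurable_subalgebra_id : measurable_fun [set: Omega] (id : Omega -> T).
Proof.
move=> _ /= B; rewrite setTI preimage_id /measurable/= sigma_algebra_id//.
exact: FM.
Qed.

Variables (k : R.-pker S ~> Y) (p : T -> S) (y : Omega -> Y).
Hypotheses (mp : measurable_fun setT p) (my : measurable_fun setT y).
Hypothesis law : forall E G, F E -> measurable G ->
  P (E `&` y @^-1` G) = \int[P]_(w in E) k (p w) G.


Let base : {measure set T -> \bar R} :=
  measure_function_pushforward__canonical__measure_function_Measure
    P measurable_subalgebra_id.

Let base_kernel (u : unit) : {measure set T -> \bar R} := base.

Let measurable_base_kernel U : measurable U ->
  measurable_fun [set: unit] (base_kernel ^~ U).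
Proof. by move=> mU; exact: measurable_cst. Qed.

HB.instance Definition _ :=
  isKernel.Build _ _ _ _ _ base_kernel measurable_base_kernel.

Let base_prob u : base_kernel u setT = 1.
Proof. by rewrite /base_kernel/base/= /pushforward preimage_setT probability_setT. Qed.

HB.instance Definition _ := Kernel_isProbability.Build _ _ _ _ _ base_kernel
  base_prob.

Let joint (w : Omega) : T * Y := (w : T, y w).

Let measurable_joint : measurable_fun setT joint.
Proof. by apply/measurable_fun_pairP; split => //=; exact: measurable_subalgebra_id. Qed.

Let law_joint : {measure set (T * Y) -> \bar R} :=
  measure_function_pushforward__canonical__measure_function_Measure
    P measurable_joint.

Let law_kcomp : {measure set (T * Y) -> \bar R} :=
  mkcomp base_kernel (graph_kernel k mp) tt.

Let law_eq A : measurable A -> law_joint A = law_kcomp A.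
Proof.
pose G := [set A `*` B | A in (measurable : set (set T))
                       & B in (measurable : set (set Y))].
apply: (measure_unique G (fun=> setT)).
- exact: measurable_prod_measurableType.
- move=> _ _ [X1 mX1 [X2 mX2 <-]] [Y1 mY1 [Y2 mY2 <-]].
  exists (X1 `&` Y1); first exact: measurableI.
  by exists (X2 `&` Y2); [exact: measurableI|rewrite setXI].
- by move=> _; exists setT => //; exists setT => //; rewrite setXTT.
- by apply/seteqP; split => // x _; exists 0%N.
- move=> _ [E mE [B mB <-]].
  have FE : F E by move: mE; rewrite /measurable/= sigma_algebra_id.
  rewrite /law_joint/= /pushforward.
  rewrite (_ : joint @^-1` _ = E `&` y @^-1` B)// law//.
  rewrite /law_kcomp/= /mkcomp/= /kcomp/=.
  transitivity (\int[base]_(t in E) k (p t) B).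
    rewrite ge0_integral_pushforward//.
      exact: measurable_subalgebra_id.
    apply: measurable_funTS.
    exact: (measurable_kernel (reindexed k mp) B mB).
  rewrite integral_mkcond; apply: eq_integral => t _.
  rewrite /graph_kernel/= /pushforward/= patchE /reindexed -xsectionE.
  by case: ifPn => tE; [rewrite in_xsectionX|rewrite notin_xsectionX// measure0].
- move=> _; rewrite /law_joint/= /pushforward preimage_setT probability_setT.
  exact: ltry.
Qed.

(** The pair [(w, y w)] and the pair obtained by drawing the past [w] first and
    then the second component from [k (p w)] have the same law: by hypothesis
    the two laws agree on rectangles, which generate the product sigma-algebra.
    Taking the past with its own sigma-algebra [F] is what allows [h] to depend
    on [w] through anything known. *)
Lemma integral_disintegration (h : T * Y -> \bar R) : (forall z, 0 <= h z) ->
  measurable_fun setT h ->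
  \int[P]_w h (w, y w) = \int[P]_w \int[k (p w)]_z h (w, z).
Proof.
move=> h0 mh.
transitivity (\int[law_joint]_z h z).
  by rewrite ge0_integral_pushforward.
transitivity (\int[law_kcomp]_z h z).
  by apply: eq_measure_integral => A mA _; exact: law_eq.
rewrite (integral_kcomp base_kernel (graph_kernel k mp) tt)//.
transitivity (\int[base]_t \int[k (p t)]_z h (t, z)).
  apply: eq_integral => t _; rewrite ge0_integral_pushforward//.
rewrite ge0_integral_pushforward//.
- exact: measurable_subalgebra_id.
- exact: (measurable_fun_integral_finite_kernel h (reindexed k mp)).
- by move=> t _; apply: integral_ge0 => z _.
Qed.

End Disintegration.

(** * A strong law for bounded orthogonal increments *)

(** Growth [o(n)] along a sample path, as the strong law delivers it. *)
Definition sublinear {R : realType} (u : nat -> R) : Prop :=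
  forall e, 0 < e -> exists N, forall n, (N <= n)%N -> `|u n| <= e * n%:R.

Section Subsequence.
Context {R : realType}.

Lemma square_bracket (n : nat) : exists k, (k ^ 2 <= n < k.+1 ^ 2)%N.
Proof.
elim: n => [|n [k /andP[k1 k2]]]; first by exists 0%N.
have [h|h] := ltnP n.+1 (k.+1 ^ 2); first by exists k; rewrite h leqW.
by exists k.+1; rewrite h/=; apply: (leq_ltn_trans k2); rewrite ltn_exp2r.
Qed.

(** Between two consecutive squares there are only [O(k)] terms, each bounded,
    which is negligible with respect to [k ^ 2]. *)
Lemma sublinear_of_squares (x : nat -> R) (c : R) :
  (forall n, `|x n| <= c) ->
  (forall e, 0 < e -> exists N, forall k, (N <= k)%N ->
     `|\sum_(0 <= t < k ^ 2) x t| <= e * (k ^ 2)%:R) ->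
  sublinear (fun n => \sum_(0 <= t < n) x t).
Proof.
move=> xc sq e e0.
have c0 : 0 <= c := le_trans (normr_ge0 _) (xc 0%N).
have [N hN] := sq (e / 2) ltac:(lra).
pose K := maxn N (Num.truncn (4 * c / e)).+1.
exists (K ^ 2)%N => n Kn.
have [k /andP[k1 k2]] := square_bracket n.
have Kk : (K <= k)%N.
  by rewrite -ltnS -(@ltn_exp2r _ _ 2)//; exact: leq_ltn_trans Kn k2.
have kc : 4 * c / e <= k%:R.
  apply: (le_trans (ltW (truncnS_gt _))); rewrite ler_nat.
  by apply: leq_trans Kk; rewrite leq_max leqnn orbT.
rewrite (@big_cat_nat _ _ _ (k ^ 2)%N)//=; apply: (le_trans (ler_normD _ _)).
have h1 := hN k (leq_trans (leq_maxl _ _) Kk).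
have h2 : `|\sum_(k ^ 2 <= t < n) x t| <= c * (2 * k%:R).
  apply: (le_trans (ler_norm_sum _ _ _)).
  apply: (@le_trans _ _ (\sum_(k ^ 2 <= t < n) c)); first exact: ler_sum.
  rewrite sumr_const_nat -[leLHS]mulr_natr -natrM ler_wpM2l// ler_nat; lia.
have h3 : (k ^ 2)%:R <= n%:R :> R by rewrite ler_nat.
have h4 : c * (2 * k%:R) <= e / 2 * (k ^ 2)%:R.
  move: kc; rewrite ler_pdivrMr// => kc.
  have : 0 <= k%:R :> R by []. 
  by rewrite natrX => k0; nra.
nra.
Qed.

End Subsequence.

Section StrongLaw.
Context d (Omega : measurableType d) (R : realType) (P : probability Omega R).

Lemma bounded_integrable (f : Omega -> R) c : measurable_fun setT f ->
  (forall w, `|f w| <= c) -> P.-integrable setT (EFin \o f).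
Proof.
move=> mf fc; apply: measurable_bounded_integrable => //.
  exact: le_lt_trans (probability_le1 P measurableT) (ltry _).
exists c; split; first exact: num_real.
by move=> x cx w _; apply: le_trans (fc w) _; exact: ltW.
Qed.

Variables (X : nat -> Omega -> R) (c : R).
Hypotheses (mX : forall n, measurable_fun setT (X n))
  (Xc : forall n w, `|X n w| <= c)
  (X_orth : forall s t, (s < t)%N -> \int[P]_w (X s w * X t w) = 0).

Let S n w := \sum_(0 <= t < n) X t w.

Let mS n : measurable_fun setT (S n).
Proof. by apply: measurable_sum => i; exact: mX. Qed.

Let c0 : 0 <= c. Proof. exact: le_trans (normr_ge0 _) (Xc 0%N point). Qed.

Let Sc n w : `|S n w| <= n%:R * c.
Proof.
apply: (le_trans (ler_norm_sum _ _ _)).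
apply: (@le_trans _ _ (\sum_(0 <= t < n) c)); first exact: ler_sum.
by rewrite sumr_const_nat subn0 -[leLHS]mulr_natl.
Qed.

Let normM (a b x y : R) : `|a| <= x -> `|b| <= y -> `|a * b| <= x * y.
Proof. by move=> ax by'; rewrite normrM ler_pM. Qed.

Let cross n : \int[P]_w (S n w * X n w) = 0.
Proof.
rewrite /S.
suff H m : (m <= n)%N -> \int[P]_w ((\sum_(0 <= t < m) X t w) * X n w) = 0.
  exact: H.
elim: m => [|m IH] mn.
  under eq_Rintegral do rewrite big_nil mul0r.
  by rewrite Rintegral_cst// mul0r.
under eq_Rintegral do rewrite big_nat_recr//= mulrDl.
rewrite RintegralD//; first by rewrite IH ?X_orth ?addr0// ltnW.
- apply: (@bounded_integrable _ (m%:R * c * c)) => [|w].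
    exact: measurable_funM (mS m) (mX n).
  exact: normM (Sc m w) (Xc n w).
- apply: (@bounded_integrable _ (c * c)) => [|w].
    exact: measurable_funM (mX m) (mX n).
  exact: normM.
Qed.

Let second_moment n : \int[P]_w (S n w ^+ 2) <= n%:R * c ^+ 2.
Proof.
elim: n => [|n IH].
  rewrite /S; under eq_Rintegral do rewrite big_nil expr0n/=.
  by rewrite Rintegral_cst// !mul0r.
have E w : S n.+1 w ^+ 2 = S n w ^+ 2 + (2 * (S n w * X n w) + X n w ^+ 2).
  by rewrite /S big_nat_recr//=; ring.
under eq_Rintegral do rewrite E.
have i1 : P.-integrable setT (EFin \o (fun w => S n w ^+ 2)).
  apply: (@bounded_integrable _ ((n%:R * c) * (n%:R * c))) => [|w].
    exact: measurable_funX (mS n).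
  exact: normM.
have i2 : P.-integrable setT (EFin \o (fun w => S n w * X n w)).
  apply: (@bounded_integrable _ ((n%:R * c) * c)) => [|w].
    exact: measurable_funM (mS n) (mX n).
  exact: normM.
have i2' : P.-integrable setT (EFin \o (fun w => 2 * (S n w * X n w))).
  exact: integrableZl i2.
have i3 : P.-integrable setT (EFin \o (fun w => X n w ^+ 2)).
  apply: (@bounded_integrable _ (c * c)) => [|w].
    exact: measurable_funX (mX n).
  exact: normM.
rewrite RintegralD//; last exact: integrableD i2' i3.
rewrite RintegralD// RintegralZl// cross mulr0 add0r.
rewrite -natr1 mulrDl mul1r; apply: lerD => //.
have -> : c ^+ 2 = \int[P]_w (c ^+ 2).
  by rewrite Rintegral_cst//= probability_setT mulr1.
apply: le_Rintegral => //.
  apply: (@bounded_integrable (fun=> c ^+ 2) `|c ^+ 2|) => //.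
move=> w _; rewrite -(real_normK (num_real (X n w))).
by rewrite ler_pXn2r ?nnegrE.
Qed.

(** Orthogonality makes the second moment of the partial sum grow linearly, so
    that the squared averages along the squares have summable expectations;
    their sum is then almost surely finite and its terms tend to [0]. *)
Theorem strong_law_orthogonal :
  {ae P, forall w, sublinear (fun n => \sum_(0 <= t < n) X t w)}.
Proof.
pose f k w := ((S (k.+1 ^ 2) w / (k.+1 ^ 2)%:R) ^+ 2)%:E.
have mf k : measurable_fun setT (f k).
  apply/measurable_EFinP/measurable_funX/measurable_funM => //.
have f0 k w : (0 <= f k w)%E by rewrite lee_fin sqr_ge0.
have ifk k : (\int[P]_w f k w <= (c ^+ 2 * 2 * (k.+1%:R^-1 - k.+2%:R^-1))%:E)%E.
  have k0 : 0 < (k.+1 ^ 2)%:R :> R by rewrite ltr0n expn_gt0.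
  have i1 : P.-integrable setT (EFin \o (fun w => S (k.+1 ^ 2) w ^+ 2)).
    apply: (@bounded_integrable _ (((k.+1 ^ 2)%:R * c) * ((k.+1 ^ 2)%:R * c))) => [|w].
      exact: measurable_funX (mS _).
    exact: normM.
  rewrite /f; under eq_integral do rewrite expr_div_n mulrC EFinM.
  rewrite integralZl// -(fineK (integrable_fin_num measurableT i1)) -EFinM lee_fin.
  apply: (@le_trans _ _ (((k.+1 ^ 2)%:R ^+ 2)^-1 * ((k.+1 ^ 2)%:R * c ^+ 2))).
    by rewrite ler_wpM2l ?invr_ge0 ?sqr_ge0//; exact: second_moment.
  have -> : ((k.+1 ^ 2)%:R ^+ 2)^-1 * ((k.+1 ^ 2)%:R * c ^+ 2)
      = c ^+ 2 * ((k.+1 ^ 2)%:R)^-1 :> R.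
    by move: k0; set a := (k.+1 ^ 2)%:R => a0; field; exact: lt0r_neq0.
  rewrite -mulrA ler_wpM2l ?sqr_ge0// natrX.
  have k1 : 0 < k.+1%:R :> R by rewrite ltr0n.
  have -> : k.+2%:R = k.+1%:R + 1 :> R by rewrite natr1.
  have k2 : 1 <= k.+1%:R :> R by rewrite ler1n.
  have -> : 2 * (k.+1%:R^-1 - (k.+1%:R + 1)^-1)
      = k.+1%:R ^- 2 * (2 * k.+1%:R / (k.+1%:R + 1)) :> R.
    by field; apply/andP; split; apply: lt0r_neq0; lra.
  rewrite ler_peMr ?invr_ge0 ?sqr_ge0// ler_pdivlMr; lra.
have sumf : (\int[P]_w (\sum_(0 <= k <oo) f k w) <= (c ^+ 2 * 2)%:E)%E.
  rewrite integral_nneseries//; apply: lime_le.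
    by apply: is_cvg_nneseries => k _ _; apply: integral_ge0.
  apply: nearW => n.
  apply: (@le_trans _ _ (c ^+ 2 * 2 * (1 - n.+1%:R^-1))%:E).
    elim: n => [|n IH]; first by rewrite big_nil invr1 subrr mulr0.
    rewrite big_nat_recr//=; apply: (le_trans (leeD IH (ifk n))).
    by rewrite -EFinD lee_fin -mulrDr addrA subrK.
  rewrite lee_fin ler_piMr ?mulr_ge0 ?sqr_ge0// gerBl; exact: invr_ge0.
have : P.-integrable setT (fun w => \sum_(0 <= k <oo) f k w)%E.
  apply/integrableP; split; first exact: ge0_emeasurable_sum.
  under eq_integral do rewrite gee0_abs ?nneseries_ge0//.
  exact: le_lt_trans sumf (ltry _).
move=> /(integrable_ae measurableT); apply: filterS => w /(_ Logic.I) fin.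
apply: (@sublinear_of_squares _ _ c) => // e e0.
have tail := @nneseries_tail_cvg _ (f^~ w) xpredT.
have {}tail := tail _ (fun k _ => f0 k w).
have sfin : (\sum_(0 <= k <oo) f k w < +oo)%E by rewrite ltey_eq fin.
have e2 : 0 < e ^+ 2 by rewrite exprn_gt0.
have /fine_cvgP[finN] := tail sfin.
move/cvgrPdist_lt/(_ _ e2) => [N2 _ hN2].
move: finN => [N1 _ hN1].
exists (maxn N1 N2).+1 => -[//|k]; rewrite ltnS geq_max => /andP[k1 k2].
have := hN2 k k2; rewrite /= sub0r normrN => h.
have : (f k w <= (e ^+ 2)%:E)%E.
  apply: (@le_trans _ _ (\sum_(k <= i <oo) f i w)%E).
    have := @nneseries_lim_ge _ (f^~ w) xpredT k k.+1 (fun n _ _ => f0 n w).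
    by rewrite big_nat1.
  rewrite -(fineK (hN1 k k1)) lee_fin; apply: le_trans (ltW h).
  exact: ler_norm.
have k0 : 0 < (k.+1 ^ 2)%:R :> R by rewrite ltr0n expn_gt0.
rewrite lee_fin -(real_normK (num_real (_ / _))) ler_pXn2r ?nnegrE ?(ltW e0)//.
by rewrite normrM normfV (gtr0_norm k0) ler_pdivrMr.
Qed.

End StrongLaw.

(** * Arrivals given the history of a process *)

Lemma known_measurable (R : realType) (Omega : pointedType) (F : set (set Omega))
    (f : Omega -> R) : known F f ->
  measurable_fun setT (f : g_sigma_algebraType F -> R).
Proof.
move=> kf _ B mB; apply: sub_sigma_algebra; apply: kf; exists B => //.
Qed.

Lemma measurable_finer (Omega : pointedType) (F G : set (set Omega))
    d' (Y : measurableType d') (f : Omega -> Y) : F `<=` G ->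
  measurable_fun setT (f : g_sigma_algebraType F -> Y) ->
  measurable_fun setT (f : g_sigma_algebraType G -> Y).
Proof.
move=> FG mf mT B mB; have := mf measurableT B mB.
exact: sub_sigma_algebra2.
Qed.

Section SlotLaw.
Context (R : realType) (arr : R.-pker R ~> (R * R)%type) (p : R).

Definition slot_law : set (R * R) -> \bar R := arr p.

HB.instance Definition _ := Measure.copy slot_law (arr p : set (R * R) -> \bar R).

HB.instance Definition _ := Measure_isProbability.Build _ _ _ slot_law
  (prob_kernel p).

End SlotLaw.

Section Process.
Context (R : realType) (D : set R) (arr : R.-pker R ~> (R * R)%type)
  d (Omega : measurableType d) (P : probability Omega R) (Sbar : R)
  (X : process R Omega).
Hypothesis admX : admissible P D arr Sbar X.

Notation F t := (g_sigma_algebraType (history X t)).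

Definition arrivals t (w : Omega) : R * R :=
  (server_arrivals X t w, customer_arrivals X t w).

Lemma history_sigma t : sigma_algebra setT (history X t).
Proof. by have [[/(_ t)[]]] := admX. Qed.

Lemma history_measurable t : history X t `<=` measurable.
Proof. by have [[/(_ t)[]]] := admX. Qed.

Lemma history_monotone s t : (s <= t)%N -> history X s `<=` history X t.
Proof.
move=> /subnK <-; elim: (t - s)%N => [//|n IH].
by apply: (subset_trans IH); have [[/(_ (n + s)%N)[]]] := admX.
Qed.

Lemma known_is_measurable t d' (Y : measurableType d') (f : F t -> Y) :
  measurable_fun setT f -> measurable_fun setT (f : Omega -> Y).
Proof.
move=> mf; exact: (measurableT_comp mf
  (measurable_subalgebra_id (history_sigma t) (@history_measurable t))).
Qed.

Lemma arrivals_known t : measurable_fun setT (arrivals t : F t.+1 -> _).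
Proof.
have [[_ /(_ t)[kA kB _ _]] _ _ _ _] := admX.
by apply/measurable_fun_pairP; split; exact: known_measurable.
Qed.

Lemma price_known t : measurable_fun setT (price X t : F t -> R).
Proof. have [[_ /(_ t)[_ _ kp _]] _ _ _ _] := admX; exact: known_measurable. Qed.

Lemma num_matched_known t : measurable_fun setT (num_matched X t : F t.+1 -> R).
Proof.
have [[_ /(_ t)[_ _ _ km]] _ _ _ _] := admX.
apply: measurable_sum => s; exact: known_measurable.
Qed.

Lemma arrivals_measurable t : measurable_fun setT (arrivals t).
Proof.
exact: known_is_measurable (@arrivals_known t).
Qed.

Lemma servers_known t : measurable_fun setT (servers X t : F t -> R).
Proof.
have [_ _ _ dyn _] := admX.
elim: t => [|t IH].
  rewrite (_ : servers X 0 = cst 0); first exact: measurable_cst.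
  by apply/funext => w; have [] := dyn w.
rewrite (_ : servers X t.+1 = fun w => Num.min (Num.max 0 (servers X t w
    + (arrivals t w).1 - num_matched X t w)) Sbar); last first.
  by apply/funext => w; have [_ _ -> _] := dyn w.
apply: measurable_minr => //; apply: measurable_maxr => //.
apply: measurable_funB; last exact: (@num_matched_known t).
apply: measurable_funD.
  exact: measurable_finer (history_monotone (leqnSn t)) IH.
exact: (measurableT_comp measurable_fst (@arrivals_known t)).
Qed.

Lemma customers_known t : measurable_fun setT (customers X t : F t -> R).
Proof.
have [_ _ _ dyn _] := admX.
elim: t => [|t IH].
  rewrite (_ : customers X 0 = cst 0); first exact: measurable_cst.
  by apply/funext => w; have [] := dyn w.
rewrite (_ : customers X t.+1 = fun w => Num.max 0 (customers X t w
    + (arrivals t w).2 - num_matched X t w)); last first.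
  by apply/funext => w; have [_ _ _ ->] := dyn w.
apply: measurable_maxr => //.
apply: measurable_funB; last exact: (@num_matched_known t).
apply: measurable_funD.
  exact: measurable_finer (history_monotone (leqnSn t)) IH.
exact: (measurableT_comp measurable_snd (@arrivals_known t)).
Qed.

Lemma integral_arrivals t (h : F t * (R * R) -> \bar R) :
  (forall z, 0 <= h z)%E -> measurable_fun setT h ->
  (\int[P]_w h (w, arrivals t w) = \int[P]_w \int[arr (price X t w)]_z h (w, z))%E.
Proof.
move=> h0 mh.
apply: (integral_disintegration (history_sigma t) (@history_measurable t)
  (@price_known t) (@arrivals_measurable t)) => //.
by move=> E G FE mG; have [_ + _ _ _] := admX; move=> /(_ t E G FE mG).
Qed.

Section ConstantPrice.
Variable pstar : R.
Hypothesis price_cst : forall t w, price X t w = pstar.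
Notation nu := (slot_law arr pstar).

Lemma integral_arrivals_independent t (Z : F t -> R) (g : R * R -> R) :
  measurable_fun setT Z -> (forall w, 0 <= Z w) ->
  measurable_fun setT g -> (forall z, 0 <= g z) ->
  (\int[P]_w (Z w * g (arrivals t w))%:E
   = \int[P]_w (Z w)%:E * \int[nu]_z (g z)%:E)%E.
Proof.
move=> mZ Z0 mg g0.
rewrite (@integral_arrivals t (fun z => (Z z.1 * g z.2)%:E)); first last.
- apply/measurable_EFinP; apply: measurable_funM.
    exact: measurableT_comp mZ measurable_fst.
  exact: measurableT_comp mg measurable_snd.
- by move=> z; rewrite lee_fin mulr_ge0.
rewrite -ge0_integralZr//; first last.
- by apply: integral_ge0 => z _; rewrite lee_fin.
- by move=> w _; rewrite lee_fin.
- apply/measurable_EFinP; exact: known_is_measurable mZ.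
apply: eq_integral => w _ /=; rewrite price_cst.
under eq_integral do rewrite EFinM.
rewrite ge0_integralZl//.
- exact/measurable_EFinP.
- by move=> z _; rewrite lee_fin.
- by rewrite lee_fin.
Qed.

Lemma expectation_arrivals t (g : R * R -> R) :
  measurable_fun setT g -> (forall z, 0 <= g z) ->
  (\int[P]_w (g (arrivals t w))%:E = \int[nu]_z (g z)%:E)%E.
Proof.
move=> mg g0; transitivity (\int[P]_w (1 * g (arrivals t w))%:E)%E.
  by apply: eq_integral => w _; rewrite mul1r.
rewrite (@integral_arrivals_independent t (fun=> 1) g)//.
by rewrite integral_cst//= [X in (1 * X)%E]probability_setT !mul1e.
Qed.

(** Under a constant price the arrivals are independent of the past. The product
    formula is available for nonnegative factors; it extends to a bounded [Z] by
    applying it to [Z + c1]. *)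
Lemma innovation_mean0 t (Z : F t -> R) (g : R * R -> R) c1 c2 :
  measurable_fun setT Z -> (forall w, `|Z w| <= c1) ->
  measurable_fun setT g -> (forall z, 0 <= g z <= c2) ->
  \int[P]_w (Z w * (g (arrivals t w) - \int[nu]_z g z)) = 0.
Proof.
move=> mZ Zc mg gc.
have mZ' := known_is_measurable mZ.
have mga : measurable_fun setT (g \o arrivals t).
  exact: measurableT_comp mg (@arrivals_measurable t).
have g0 z : 0 <= g z by have /andP[] := gc z.
have gabs z : `|g z| <= c2 by rewrite ger0_norm//; have /andP[] := gc z.
have c10 : 0 <= c1 := le_trans (normr_ge0 _) (Zc point).
have iga : P.-integrable setT (EFin \o (g \o arrivals t)).
  by apply: (@bounded_integrable _ _ _ _ _ c2) => // w; exact: gabs.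
have iZ : P.-integrable setT (EFin \o (Z : Omega -> R)).
  exact: (@bounded_integrable _ _ _ _ _ c1).
have iZg : P.-integrable setT (EFin \o (fun w => Z w * g (arrivals t w))).
  apply: (@bounded_integrable _ _ _ _ _ (c1 * c2)) => [|w].
    exact: measurable_funM.
  by rewrite normrM ler_pM.
have Eg : \int[P]_w g (arrivals t w) = \int[nu]_z g z.
  by rewrite /Rintegral; congr fine; exact: expectation_arrivals.
have iZc : P.-integrable setT (EFin \o (fun w => Z w + c1)).
  apply: (@bounded_integrable _ _ _ _ _ (c1 + c1)) => [|w].
    exact: measurable_funD.
  by apply: le_trans (ler_normD _ _) _; rewrite lerD// ger0_norm.
have ig : (nu : probability _ _).-integrable setT (EFin \o g).
  exact: (@bounded_integrable _ _ _ _ _ c2).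
have key : \int[P]_w ((Z w + c1) * g (arrivals t w))
    = \int[P]_w (Z w + c1) * \int[nu]_z g z.
  rewrite /Rintegral.
  rewrite (@integral_arrivals_independent t (fun w => Z w + c1))//.
  - rewrite fineM//.
    + exact: (integrable_fin_num measurableT iZc).
    + exact: (integrable_fin_num measurableT ig).
  - exact: measurable_funD.
  - by move=> w; have := Zc w; rewrite ler_norml => /andP[]; lra.
have cst_int : P.-integrable setT (EFin \o (fun=> c1)).
  exact: (@bounded_integrable _ _ _ _ _ `|c1|).
have c1g : P.-integrable setT (EFin \o (fun w => c1 * g (arrivals t w))).
  exact: integrableZl iga.
have gZ : P.-integrable setT (EFin \o (fun w => Z w * \int[nu]_z g z)).
  exact: integrableZr iZ.
have E1 : \int[P]_w ((Z w + c1) * g (arrivals t w))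
    = \int[P]_w (Z w * g (arrivals t w)) + c1 * \int[nu]_z g z.
  under eq_Rintegral do rewrite mulrDl.
  by rewrite RintegralD// RintegralZl// Eg.
have E2 : \int[P]_w (Z w + c1) = \int[P]_w Z w + c1.
  by rewrite RintegralD// Rintegral_cst//= [X in fine X]probability_setT mulr1.
have -> : \int[P]_w (Z w * (g (arrivals t w) - \int[nu]_z g z))
    = \int[P]_w (Z w * g (arrivals t w)) - \int[P]_w Z w * \int[nu]_z g z.
  under eq_Rintegral do rewrite mulrBr.
  by rewrite RintegralB// RintegralZr.
by move: key; rewrite E1 E2 mulrDl => /addIr ->; rewrite subrr.
Qed.

(** Products of two innovations of different slots have mean [0], since the
    earlier one is known when the later arrivals occur. *)
Theorem strong_law_innovations (Z : nat -> Omega -> R) (g : R * R -> R) c1 c2 :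
  (forall t, measurable_fun setT (Z t : F t -> R)) ->
  (forall t w, `|Z t w| <= c1) ->
  measurable_fun setT g -> (forall z, 0 <= g z <= c2) ->
  {ae P, forall w, sublinear (fun n =>
    \sum_(0 <= t < n) Z t w * (g (arrivals t w) - \int[nu]_z g z))}.
Proof.
move=> mZ Zc mg gc.
set ghat := \int[nu]_z g z.
pose I t w := Z t w * (g (arrivals t w) - ghat).
have mI t : measurable_fun setT (I t : F t.+1 -> R).
  apply: measurable_funM.
    exact: measurable_finer (history_monotone (leqnSn t)) (mZ t).
  apply: measurable_funB => //.
  exact: measurableT_comp mg (@arrivals_known t).
have Ic t w : `|I t w| <= c1 * (c2 + `|ghat|).
  rewrite normrM ler_pM//; apply: le_trans (ler_normB _ _) _; rewrite lerD2r.
  by have /andP[? ?] := gc (arrivals t w); rewrite ger0_norm.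
apply: (@strong_law_orthogonal _ _ _ _ I (c1 * (c2 + `|ghat|))) => //.
  by move=> t; exact: known_is_measurable (mI t).
move=> s t st.
have -> : \int[P]_w (I s w * I t w) =
    \int[P]_w ((I s w * Z t w) * (g (arrivals t w) - ghat)).
  by apply: eq_Rintegral => w _; rewrite /I mulrA.
apply: (@innovation_mean0 t (fun w => I s w * Z t w) g
  (c1 * (c2 + `|ghat|) * c1) c2) => //.
  apply: measurable_funM => //.
  exact: measurable_finer (history_monotone st) (mI s).
by move=> w; rewrite normrM ler_pM.
Qed.

End ConstantPrice.
End Process.

(** * The upper bound on the optimal profit *)

Section LowerLimits.
Context {R : realType}.
Local Open Scope ereal_scope.

Lemma le_limn_einf (u v : nat -> \bar R) N : (forall n, (N <= n)%N -> u n <= v n) ->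
  limn_einf u <= limn_einf v.
Proof.
move=> uv; rewrite !limn_einf_lim; apply: lee_lim; [exact: is_cvg_einfs..|].
exists N => // n /= Nn; apply: le_ereal_inf_tmp => _ [k /= nk <-].
apply: ge_ereal_inf; exists (u k); first by exists k.
exact/uv/(leq_trans Nn).
Qed.

Lemma limn_einf_cst (c : \bar R) : limn_einf (fun=> c) = c.
Proof. by have [] := @cvg_limn_einf_sup R (fun=> c) c (@cvg_cst _ _ _ _ _). Qed.

Lemma measurable_limn_einf d (T : measurableType d) (f : nat -> T -> \bar R) :
  (forall n, measurable_fun setT (f n)) ->
  measurable_fun setT (fun x => limn_einf (f^~ x)).
Proof.
move=> mf.
rewrite (_ : (fun x => _) = fun x => - limn_esup (fun n => - f n x)).
  apply: measurableT_comp => //; apply: measurable_fun_limn_esup => n.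
  exact: measurableT_comp.
apply/funext => x; rewrite -limn_einfN; congr limn_einf.
by apply/funext => n /=; rewrite oppeK.
Qed.

End LowerLimits.

Section SlotMeans.
Context (R : realType) (D : set R) (lambda : R) (mu : R -> R)
  (arr : R.-pker R ~> (R * R)%type).
Hypothesis arrP : arrival_model D lambda mu arr.
Variable p : R.
Hypothesis Dp : D p.
Local Open Scope ereal_scope.

Lemma slot_law_ge0 : {ae slot_law arr p, forall z, 0 <= z.1 /\ 0 <= z.2}%R.
Proof.
have [/(_ p Dp) h _ _ _] := arrP.
have mN : measurable [set x : R * R | (0 <= x.1 /\ 0 <= x.2)%R].
  have -> : [set x : R * R | (0 <= x.1 /\ 0 <= x.2)%R]
      = (fst @^-1` `[0%R, +oo[ `&` snd @^-1` `[0%R, +oo[)%classic.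
    by apply/seteqP; split=> z /=; rewrite !in_itv/= !andbT.
  apply: measurableI; rewrite -[X in measurable X]setTI.
    exact: measurable_fst.
  exact: measurable_snd.
exists (~` [set x : R * R | (0 <= x.1 /\ 0 <= x.2)%R]); split.
- exact: measurableC.
- by rewrite (probability_setC (slot_law arr p))//= /slot_law h subee.
- by move=> z /=.
Qed.

Lemma slot_mean_servers :
  \int[slot_law arr p]_z (Num.max 0%R z.1)%:E = lambda%:E.
Proof.
have [_ _ /(_ p Dp) <- _] := arrP.
apply: ae_eq_integral => //.
- by apply/measurable_EFinP; apply: measurable_maxr => //; exact: measurable_fst.
- by apply/measurable_EFinP; exact: measurable_fst.
- by apply: filterS slot_law_ge0 => z [z1 _] _; rewrite max_r.
Qed.

Lemma slot_mean_customers :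
  \int[slot_law arr p]_z (Num.max 0%R z.2)%:E = (mu p)%:E.
Proof.
have [_ _ _ /(_ p Dp) <-] := arrP.
apply: ae_eq_integral => //.
- by apply/measurable_EFinP; apply: measurable_maxr => //; exact: measurable_snd.
- by apply/measurable_EFinP; exact: measurable_snd.
- by apply: filterS slot_law_ge0 => z [_ z2] _; rewrite max_r.
Qed.

Lemma customer_rate_ge0 : (0 <= mu p)%R.
Proof.
rewrite -lee_fin -slot_mean_customers; apply: integral_ge0 => z _.
by rewrite lee_fin le_max lexx.
Qed.

End SlotMeans.

Section UpperBound.
Context (R : realType) (D : set R) (lambda : R) (mu : R -> R)
  (arr : R.-pker R ~> (R * R)%type) (V : R -> R) (x0 a c : R).
Hypotheses (D_ge0 : forall p, D p -> 0 <= p)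
  (arrP : arrival_model D lambda mu arr)
  (rate_le : forall q, D q -> q * mu q <= x0)
  (V_nondec : forall x y, 0 <= x -> x <= y -> V x <= V y)
  (a0 : 0 <= a) (V_le : forall y, 0 <= y -> V y <= c + a * y).

Section OnePolicy.
Context (Sbar : R) d (Omega : measurableType d) (P : probability Omega R)
  (X : process R Omega).
Hypothesis admX : admissible P D arr Sbar X.

Lemma revenue_ge0 t w : 0 <= revenue X t w.
Proof.
have [_ _ /(_ _ _)H _ /(_ w)[m0 _ _]] := admX.
apply: sumr_ge0 => s _; rewrite mulr_ge0//; apply: D_ge0.
by have [] := H s w.
Qed.

(** A customer pays at most once, so what is collected is bounded by what has
    been committed. *)
Lemma total_revenue_le T w :
  \sum_(0 <= t < T) revenue X t w
    <= \sum_(0 <= t < T) price X t w * customer_arrivals X t w.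
Proof.
have [_ _ H _ /(_ w)[m0 mB _]] := admX.
apply: (@le_trans _ _
  (\sum_(0 <= s < T) price X s w * \sum_(s <= t < T) matched X s t w)).
  elim: T => [|T IH]; first by rewrite !big_nil.
  rewrite [leLHS]big_nat_recr//=.
  have -> : \sum_(0 <= s < T.+1) price X s w * (\sum_(s <= t < T.+1) matched X s t w)
     = \sum_(0 <= s < T) price X s w * (\sum_(s <= t < T) matched X s t w)
       + \sum_(0 <= s < T.+1) price X s w * matched X s T w.
    rewrite big_nat_recr//= [X in _ = _ + X]big_nat_recr//= addrA big_nat1; congr +%R.
    rewrite -big_split/=; apply: eq_big_nat => s /andP[_ sT].
    by rewrite big_nat_recr ?(ltnW sT)//= mulrDr.
  by apply: lerD => //; rewrite big_mkord.
rewrite !big_mkord; apply: ler_sum => s _; apply: ler_wpM2l; last exact: mB.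
by apply: D_ge0; have [] := H s w.
Qed.

(** Given the past, the amount committed in slot [t] has mean [p * mu p] at the
    posted price [p]. *)
Lemma slot_revenue_mean t :
  (\int[P]_w (price X t w * customer_arrivals X t w)%:E <= x0%:E)%E.
Proof.
have [_ _ H _ _] := admX.
have p0 w : 0 <= price X t w by apply: D_ge0; have [] := H t w.
pose h (z : g_sigma_algebraType (history X t) * (R * R)) : \bar R :=
  (price X t z.1 * Num.max 0 z.2.2)%:E.
have mp := @price_known _ _ _ _ _ _ _ _ admX t.
have mmax : measurable_fun setT (fun z : R * R => Num.max 0 z.2).
  by apply: measurable_maxr => //; exact: measurable_snd.
have -> : (\int[P]_w (price X t w * customer_arrivals X t w)%:E
    = \int[P]_w h (w, arrivals X t w))%E.
  apply: eq_integral => w _; rewrite /h/= max_r//; by have [] := H t w.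
rewrite (integral_arrivals admX); first last.
- apply/measurable_EFinP; apply: measurable_funM.
    exact: measurableT_comp mp measurable_fst.
  exact: measurableT_comp mmax measurable_snd.
- by move=> z; rewrite lee_fin mulr_ge0// le_max lexx.
have inner w : (\int[arr (price X t w)]_z h (w, z)
    = (price X t w * mu (price X t w))%:E)%E.
  have Dp : D (price X t w) by have [] := H t w.
  rewrite /h/=; under eq_integral do rewrite EFinM.
  rewrite ge0_integralZl//; last 3 first.
  - exact/measurable_EFinP.
  - by move=> z _; rewrite lee_fin le_max lexx.
  - by rewrite lee_fin.
  by have := slot_mean_customers arrP Dp; rewrite /slot_law => ->; rewrite EFinM.
under eq_integral do rewrite inner.
apply: (@le_trans _ _ (\int[P]_w (cst x0%:E) w)%E); last first.
  by rewrite integral_cst//= probability_setT mule1.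
apply: ge0_le_integral => //.
- move=> w _; rewrite lee_fin mulr_ge0//.
  by apply: (customer_rate_ge0 arrP); have [] := H t w.
- have := @measurable_fun_integral_finite_kernel _ _ _ _ _ h
    (reindexed arr mp).
  have E : (fun w => \int[reindexed arr mp w]_z h (w, z))%E =
    (fun w => (price X t w * mu (price X t w))%:E).
    by apply/funext => w; rewrite -inner.
  rewrite E => mh; apply: (known_is_measurable admX (t := t)); apply: mh.
  + by move=> z; rewrite lee_fin mulr_ge0// le_max lexx.
  + apply/measurable_EFinP; apply: measurable_funM.
      exact: measurableT_comp mp measurable_fst.
    exact: measurableT_comp mmax measurable_snd.
- by move=> w _; rewrite lee_fin; apply: rate_le; have [] := H t w.
Qed.

Lemma average_revenue_mean T :
  (\int[P]_w (T%:R^-1 * \sum_(0 <= t < T) price X t w * customer_arrivals X t w)%:E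
    <= x0%:E)%E.
Proof.
have [_ _ H _ _] := admX.
have pB0 t w : 0 <= price X t w * customer_arrivals X t w.
  by rewrite mulr_ge0//; [apply: D_ge0|]; have [] := H t w.
have mpB t : measurable_fun setT (fun w => price X t w * customer_arrivals X t w).
  apply: measurable_funM.
    exact: (known_is_measurable admX (@price_known _ _ _ _ _ _ _ _ admX t)).
  exact: (measurableT_comp measurable_snd (@arrivals_measurable _ _ _ _ _ _ _ _ admX t)).
under eq_integral do rewrite EFinM.
rewrite ge0_integralZl//; last 2 first.
- by apply/measurable_EFinP; exact: measurable_sum.
- by move=> w _; rewrite lee_fin; apply: sumr_ge0.
under eq_integral do rewrite -sumEFin.
rewrite ge0_integral_sum//; last 2 first.
- by move=> t; exact/measurable_EFinP.
- by move=> t w _; rewrite lee_fin.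
have x00 : 0 <= x0.
  rewrite -lee_fin; apply: le_trans (slot_revenue_mean 0).
  by apply: integral_ge0 => w _; rewrite lee_fin.
apply: (@le_trans _ _ ((T%:R^-1)%:E * \sum_(0 <= t < T) x0%:E)%E).
  apply: lee_pmul => //.
    apply: sume_ge0 => t _; apply: integral_ge0 => w _; rewrite lee_fin//.
  by apply: lee_sum => t _; exact: slot_revenue_mean.
rewrite sumEFin -EFinM lee_fin sumr_const_nat subn0 -[x0 *+ _]mulr_natl.
case: T => [|T]; first by rewrite mulr0n mul0r mulr0.
by rewrite mulrA mulVf ?mul1r// pnatr_eq0.
Qed.

(** Fatou's lemma requires nonnegative functions, whence the shift by [V 0]. The
    comparison of the averages starts at [n = 1], as the average over no slot is
    [0], which may exceed the affine bound. *)
Lemma profit_mean_le : (\int[P]_w profit V X w <= (c + a * x0)%:E)%E.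
Proof.
have [_ _ H _ _] := admX.
have r0 := revenue_ge0.
pose u n w := n%:R^-1 * \sum_(0 <= t < n) V (revenue X t w).
pose pB n w := n%:R^-1 * \sum_(0 <= t < n) price X t w * customer_arrivals X t w.
have pB0 n w : 0 <= pB n w.
  rewrite mulr_ge0 ?invr_ge0//; apply: sumr_ge0 => t _.
  by rewrite mulr_ge0//; [apply: D_ge0|]; have [] := H t w.
have cV0 : V 0 <= c by have := V_le (lexx 0); rewrite mulr0 addr0.
have mrev t : measurable_fun setT (revenue X t).
  apply: measurable_sum => s; apply: measurable_funM.
    exact: (known_is_measurable admX (@price_known _ _ _ _ _ _ _ _ admX s)).
  apply: (known_is_measurable admX (t := t.+1)).
  have [[_ /(_ t)[_ _ _ km]] _ _ _ _] := admX; exact: known_measurable.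
have mu_ n : measurable_fun setT (u n).
  apply: measurable_funM => //; apply: measurable_sum => t.
  have -> : (fun w => V (revenue X t w)) = (V \o Num.max 0) \o revenue X t.
    by apply/funext => w /=; rewrite max_r.
  apply: measurableT_comp (mrev t); apply: nondecreasing_measurable => //.
  move=> x y xy /=; apply: V_nondec; first by rewrite le_max lexx.
  by rewrite ge_max !le_max lexx xy orbT.
have mpB n : measurable_fun setT (pB n).
  apply: measurable_funM => //; apply: measurable_sum => t; apply: measurable_funM.
    exact: (known_is_measurable admX (@price_known _ _ _ _ _ _ _ _ admX t)).
  exact: (measurableT_comp measurable_snd (@arrivals_measurable _ _ _ _ _ _ _ _ admX t)).
have u_le n w : (1 <= n)%N -> V 0 <= u n w <= c + a * pB n w.
  move=> n1; have n0 : 0 < n%:R :> R by rewrite ltr0n.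
  rewrite ler_pdivlMl// ler_pdivrMl//; apply/andP; split.
    rewrite (_ : n%:R * V 0 = \sum_(0 <= t < n) V 0).
      by apply: ler_sum => t _; exact: V_nondec.
    by rewrite sumr_const_nat subn0 mulr_natl.
  apply: (@le_trans _ _ (\sum_(0 <= t < n) (c + a * revenue X t w))).
    by apply: ler_sum => t _; exact: V_le.
  rewrite big_split/= sumr_const_nat subn0 mulrDr mulr_natl lerD2l.
  rewrite -mulr_sumr mulrCA /pB mulVKf ?gt_eqF//.
  by apply: ler_wpM2l => //; exact: total_revenue_le.
pose f w := (profit V X w - (V 0)%:E)%E.
pose h n w := (c - V 0 + a * pB n w)%:E.
have h0 n w : (0 <= h n w)%E.
  rewrite lee_fin; apply: addr_ge0.
    by rewrite subr_ge0.
  by apply: mulr_ge0; [exact: a0|exact: pB0].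
have mh n : measurable_fun setT (h n).
  apply/measurable_EFinP; apply: measurable_funD => //; exact: measurable_funM.
have fE w : f w = limn_einf (fun n => (u n w - V 0)%:E).
  rewrite /f addeC -limn_einf_shift//; congr limn_einf; apply/funext => n.
  by rewrite addeC -EFinB.
have f0 w : (0 <= f w)%E.
  rewrite fE -[X in (X <= _)%E](limn_einf_cst (0 : \bar R)).
  apply: (@le_limn_einf _ _ _ 1) => n n1; rewrite lee_fin subr_ge0.
  by have /andP[] := u_le n w n1.
have fh w : (f w <= limn_einf (h^~ w))%E.
  rewrite fE; apply: (@le_limn_einf _ _ _ 1) => n n1; rewrite lee_fin.
  by have /andP[_ ?] := u_le n w n1; lra.
have mf : measurable_fun setT f.
  rewrite (_ : f = fun w => limn_einf (fun n => (u n w - V 0)%:E)); last first.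
    by apply/funext.
  apply: (measurable_limn_einf (f := fun n w => (u n w - V 0)%:E)) => n.
  by apply/measurable_EFinP; exact: measurable_funB.
have intf : (\int[P]_w f w <= (c - V 0 + a * x0)%:E)%E.
  apply: (@le_trans _ _ (\int[P]_w limn_einf (h^~ w))%E).
    apply: ge0_le_integral => //; exact: measurable_limn_einf.
  apply: (le_trans (fatou _ _ _ _)) => //.
  rewrite -[X in (_ <= X)%E](limn_einf_cst (_ : \bar R)).
  apply: (@le_limn_einf _ _ _ 0) => n _; rewrite /h.
  under eq_integral do rewrite EFinD.
  rewrite ge0_integralD//; last 3 first.
  - by move=> w _; rewrite lee_fin subr_ge0.
  - by move=> w _; rewrite lee_fin mulr_ge0.
  - by apply/measurable_EFinP; exact: measurable_funM.
  rewrite integral_cst//= [X in (_ * X)%E]probability_setT mule1.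
  rewrite [leRHS]EFinD; apply: leeD2l.
  under eq_integral do rewrite EFinM.
  rewrite ge0_integralZl//; last 2 first.
  - exact/measurable_EFinP.
  - by move=> w _; rewrite lee_fin.
  rewrite EFinM lee_wpmul2l//; exact: average_revenue_mean.
have if_ : P.-integrable setT f.
  apply/integrableP; split => //; under eq_integral do rewrite gee0_abs//.
  exact: le_lt_trans intf (ltry _).
have -> : (\int[P]_w profit V X w = \int[P]_w (f w + (V 0)%:E))%E.
  by apply: eq_integral => w _; rewrite /f subeK.
rewrite integralD//; last by apply: (@bounded_integrable _ _ _ _ (fun=> V 0) `|V 0|).
rewrite integral_cst//= [X in (_ * X)%E]probability_setT mule1.
apply: (le_trans (leeD2r _ intf)); rewrite -EFinD lee_fin; lra.
Qed.

End OnePolicy.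

(** An affine majorant commutes with time averages and expectations, so that the
    mean revenue per slot is all that matters about a policy. *)
Theorem optimal_profit_le Sbar :
  (optimal_profit D arr Sbar V <= (c + a * x0)%:E)%E.
Proof.
apply: ge_ereal_sup => _ []d []Omega []P []X []admX _ ->.
exact: profit_mean_le admX.
Qed.

End UpperBound.

(** * The second moment of the customer arrivals *)

Section VarianceRate.
Context (R : realType) (D : set R) (lambda : R) (mu : R -> R)
  (arr : R.-pker R ~> (R * R)%type) (Sbar : R) d (Omega : measurableType d)
  (P : probability Omega R) (X : process R Omega) (pstar sigma2 : R).
Hypotheses (arrP : arrival_model D lambda mu arr) (Dp : D pstar)
  (admX : admissible P D arr Sbar X)
  (price_cst : forall t w, price X t w = pstar)
  (varX : customer_variance_rate P X sigma2).
Notation nu := (slot_law arr pstar).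
Let m := mu pstar.
Let b (z : R * R) : R := Num.max 0 z.2.
Let B t w := customer_arrivals X t w.
Let Y n w := \sum_(0 <= t < n) B t w.

Let mb : measurable_fun setT b.
Proof. by apply: measurable_maxr => //; exact: measurable_snd. Qed.

Let b0 z : 0 <= b z. Proof. by rewrite le_max lexx. Qed.

Let B0 t w : 0 <= B t w.
Proof. by have [_ _ /(_ t w)[]] := admX. Qed.

Let bB t w : b (arrivals X t w) = B t w.
Proof. by rewrite /b/= max_r//; exact: B0. Qed.

Let Y0 n w : 0 <= Y n w. Proof. exact: sumr_ge0. Qed.

Let Y_known n : measurable_fun setT (Y n : g_sigma_algebraType (history X n) -> R).
Proof.
rewrite (_ : Y n = fun w => \sum_(t < n) B t w); last first.
  by apply/funext => w; rewrite /Y big_mkord.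
apply: measurable_sum => t.
apply: measurable_finer (history_monotone admX (ltn_ord t)) _.
exact: (measurableT_comp measurable_snd (@arrivals_known _ _ _ _ _ _ _ _ admX t)).
Qed.

Let mY n : measurable_fun setT (Y n).
Proof. exact: (known_is_measurable admX (@Y_known n)). Qed.

Let mB t : measurable_fun setT (B t).
Proof.
exact: (measurableT_comp measurable_snd (@arrivals_measurable _ _ _ _ _ _ _ _ admX t)).
Qed.

Let EB t : (\int[P]_w (B t w)%:E = m%:E)%E.
Proof.
rewrite -(slot_mean_customers arrP Dp) -(expectation_arrivals admX price_cst t)//.
by apply: eq_integral => w _; rewrite -bB.
Qed.

Let EY n : (\int[P]_w (Y n w)%:E = (n%:R * m)%:E)%E.
Proof.
rewrite /Y; under eq_integral do rewrite -sumEFin.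
rewrite ge0_integral_sum//; last 2 first.
- by move=> t; exact/measurable_EFinP.
- by move=> t w _; rewrite lee_fin.
under eq_bigr do rewrite EB.
by rewrite sumEFin sumr_const_nat subn0 mulr_natl.
Qed.

Let var_def n : (variance P (Y n) = \int[P]_w ((Y n w - n%:R * m) ^+ 2)%:E)%E.
Proof.
rewrite /variance covariance.unlock expectation.unlock EY/=.
by apply: eq_integral => w _; rewrite expr2.
Qed.

(** The variance formula for a sum that is not yet known to be square
    integrable; moving the cross term to the other side leaves only integrals of
    nonnegative functions. *)
Let var_add n : (variance P (Y n) + (2 * (n%:R * m) ^+ 2)%:E
  = \int[P]_w (Y n w ^+ 2)%:E + ((n%:R * m) ^+ 2)%:E)%E.
Proof.
have m0 : 0 <= n%:R * m by apply: mulr_ge0 => //; exact: (customer_rate_ge0 arrP Dp).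
have mc := measurable_funB (@mY n) (measurable_cst (n%:R * m)).
have -> : ((2 * (n%:R * m) ^+ 2)%:E
    = \int[P]_w ((2 * (n%:R * m)) * Y n w)%:E)%E.
  under eq_integral do rewrite EFinM.
  rewrite ge0_integralZl//; last 3 first.
  - exact/measurable_EFinP.
  - by move=> w _; rewrite lee_fin.
  - by rewrite lee_fin mulr_ge0.
  by rewrite EY -EFinM expr2 mulrA.
have -> : (((n%:R * m) ^+ 2)%:E = \int[P]_w cst ((n%:R * m) ^+ 2)%:E w)%E.
  by rewrite integral_cst//= [X in (_ * X)%E]probability_setT mule1.
have mc2 := measurable_funX 2 mc.
have mY2 := measurable_funX 2 (@mY n).
have mYm := measurable_funM (measurable_cst (2 * (n%:R * m))) (@mY n).
rewrite var_def -!ge0_integralD//.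
- by apply: eq_integral => w _; rewrite -!EFinD /=; congr EFin; ring.
all: try exact/measurable_EFinP.
all: move=> w _ /=; rewrite lee_fin ?sqr_ge0//.
by apply: mulr_ge0 => //; exact: mulr_ge0.
Qed.

Let e2 := (\int[nu]_z (b z ^+ 2)%:E)%E.

Let EB2 t : (\int[P]_w (B t w ^+ 2)%:E = e2)%E.
Proof.
rewrite /e2 -(expectation_arrivals admX price_cst t); last 2 first.
- exact: measurable_funX.
- by move=> z; exact: sqr_ge0.
by apply: eq_integral => w _; rewrite -bB.
Qed.

Let EY2 n : (\int[P]_w (Y n.+1 w ^+ 2)%:E
  = \int[P]_w (Y n w ^+ 2)%:E + (2 * (n%:R * m) * m)%:E + e2)%E.
Proof.
have -> : ((2 * (n%:R * m) * m)%:E = \int[P]_w (2 * Y n w * b (arrivals X n w))%:E)%E.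
  have := integral_arrivals_independent admX price_cst (t := n)
    (Z := fun w => 2 * Y n w) (g := b).
  move=> ->//; last 2 first.
  - by apply: measurable_funM => //; exact: (@Y_known n).
  - by move=> w; rewrite mulr_ge0.
  under eq_integral do rewrite EFinM.
  rewrite ge0_integralZl//; last 2 first.
  - exact/measurable_EFinP.
  - by move=> w _; rewrite lee_fin.
  by rewrite EY (slot_mean_customers arrP Dp) -!EFinM mulrA.
have mb_ := measurableT_comp mb (@arrivals_measurable _ _ _ _ _ _ _ _ admX n).
have mYb := measurable_funM (measurable_funM (measurable_cst (2 : R)) (@mY n)) mb_.
have mY2 := measurable_funX 2 (@mY n).
have mB2 := measurable_funX 2 (@mB n).
rewrite -(EB2 n) -!ge0_integralD//.
- apply: eq_integral => w _; rewrite -!EFinD /=; congr EFin.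
  by rewrite /Y big_nat_recr//= bB; ring.
all: try exact/measurable_EFinP.
all: try by move=> w _ /=; rewrite -?EFinD lee_fin ?addr_ge0 ?sqr_ge0// !mulr_ge0.
by apply: emeasurable_funD; apply/measurable_EFinP.
Qed.

(** One finite variance suffices: the square of the sum is then integrable, and
    it dominates the square of its first term. *)
Let e2_fin : e2 \is a fin_num.
Proof.
have /fine_cvgP[[N _ hN] _] := varX.
have := hN N.+1 (leqnSn N) => fin1.
have : (variance P (Y N.+1) < +oo)%E.
  rewrite ltey; apply/eqP => vy; move: fin1; rewrite /= -/(Y N.+1) vy.
  by rewrite gt0_muley ?lte_fin ?invr_gt0 ?ltr0n.
move=> vfin; rewrite ge0_fin_numE; last first.
  by apply: integral_ge0 => z _; rewrite lee_fin sqr_ge0.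
rewrite -(EB2 0).
apply: (@le_lt_trans _ _ (\int[P]_w (Y N.+1 w ^+ 2)%:E)%E).
  apply: ge0_le_integral => //.
  - by move=> w _; rewrite lee_fin sqr_ge0.
  - by apply/measurable_EFinP; exact: measurable_funX.
  - by apply/measurable_EFinP; exact: measurable_funX.
  - move=> w _; rewrite lee_fin ler_pXn2r ?nnegrE// /Y big_nat_recl//=.
    by rewrite lerDl; exact: sumr_ge0.
have : (variance P (Y N.+1) + (2 * (N.+1%:R * m) ^+ 2)%:E < +oo)%E.
  by rewrite lte_add_pinfty// ltry.
rewrite var_add; apply: le_lt_trans; rewrite leeDl// lee_fin; exact: sqr_ge0.
Qed.

Let varY n : (variance P (Y n) = (n%:R * (fine e2 - m ^+ 2))%:E)%E.
Proof.
have EYn : (\int[P]_w (Y n w ^+ 2)%:E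
    = (n%:R * (fine e2 - m ^+ 2) + (n%:R * m) ^+ 2)%:E)%E.
  elim: n => [|n IH].
    under eq_integral do rewrite /Y big_nil expr0n/=.
    by rewrite integral0 mul0r add0r mul0r expr0n.
  rewrite EY2 IH -[in LHS](fineK e2_fin) -!EFinD; congr EFin.
  by rewrite -natr1; ring.
have := var_add n; rewrite EYn => h.
have vfin : (variance P (Y n) \is a fin_num).
  have : (variance P (Y n) + (2 * (n%:R * m) ^+ 2)%:E)%E \is a fin_num by rewrite h.
  by rewrite fin_numD => /andP[].
move: h; rewrite -(fineK vfin) -!EFinD => -[] h; congr EFin; lra.
Qed.

(** The arrivals being independent and identically distributed, the variance of
    the sum over [n] slots is [n] times the variance in one slot, so that
    [sigma2] is the latter. *)
Theorem customer_second_moment :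
  (\int[nu]_z ((Num.max 0 z.2) ^+ 2)%:E = (sigma2 + m ^+ 2)%:E)%E.
Proof.
rewrite -/e2 -(fineK e2_fin); congr EFin.
suff -> : sigma2 = fine e2 - m ^+ 2 by rewrite subrK.
apply: EFin_inj; apply: (cvg_unique _ varX) => //.
apply: cvg_near_cst; exists 1%N => // n /= n1.
rewrite -/(Y n) varY -EFinM mulrA mulVf ?mul1r//.
by rewrite pnatr_eq0 -lt0n.
Qed.

End VarianceRate.

(** * Laplace transforms of nonnegative variables *)

Section Truncation.
Context d (T : measurableType d) (R : realType) (nu : probability T R).

Lemma truncated_mean_gt (f : T -> R) (L y : R) : measurable_fun setT f ->
  (forall z, 0 <= f z) -> (\int[nu]_z (f z)%:E = L%:E)%E -> y < L ->
  exists2 n : R, 0 <= n & y < \int[nu]_z Num.min (f z) n.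
Proof.
move=> mf f0 fL yL.
pose g n z := (Num.min (f z) n%:R)%:E.
have mg n : measurable_fun setT (g n).
  by apply/measurable_EFinP; exact: measurable_minr.
have g0 n z : setT z -> (0 <= g n z)%E.
  by move=> _; rewrite lee_fin le_min f0 ler0n.
have ndg z : setT z -> {homo g ^~ z : n m / (n <= m)%N >-> (n <= m)%E}.
  move=> _ n k nk; rewrite lee_fin le_min ge_min lexx/= ge_min.
  by rewrite ler_nat nk orbT.
have cg := cvg_monotone_convergence measurableT mg g0 ndg.
have lg z : limn (g ^~ z) = (f z)%:E.
  apply/cvg_lim => //; apply: cvg_near_cst.
  exists (Num.truncn (f z)).+1 => // n /= fn; congr EFin; apply: min_l.
  by apply: (le_trans (ltW (truncnS_gt _))); rewrite ler_nat.
have EL : (\int[nu]_z limn (g ^~ z) = L%:E)%E.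
  by rewrite -fL; apply: eq_integral => z _; exact: lg.
move: (cg nu); rewrite EL => {}cg.
apply: contrapT => none; move: yL; apply/negP; rewrite -leNgt -lee_fin.
rewrite -(cvg_lim _ cg)//; apply: lime_le; first by apply/cvg_ex; exists L%:E.
apply: nearW => N; rewrite leNgt; apply/negP => h; apply: none.
exists N%:R; first exact: ler0n.
rewrite -lte_fin /Rintegral fineK//.
apply: (integrable_fin_num measurableT).
apply: (@bounded_integrable _ _ _ nu (fun z => Num.min (f z) N%:R) N%:R) => [|z].
  exact: measurable_minr.
by rewrite ger0_norm ?le_min ?f0 ?ler0n// ge_min lexx orbT.
Qed.

End Truncation.

Section Rates.
Context (R : realType) d (T : measurableType d) (nu : probability T R)
  (b : T -> R).
Hypotheses (mb : measurable_fun setT b) (b0 : forall z, 0 <= b z).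

Let mexp (th : R) : measurable_fun setT (fun z => expR (- (th * b z))).
Proof.
apply: measurableT_comp => //; apply: measurableT_comp => //.
exact: measurable_funM.
Qed.

Lemma exp_neg_itv (th x : R) : 0 <= th -> 0 <= x -> 0 <= expR (- (th * x)) <= 1.
Proof.
move=> th0 x0; rewrite expR_ge0/= -[leRHS]expR0 ler_expR oppr_le0; exact: mulr_ge0.
Qed.

Let iexp th : 0 <= th -> nu.-integrable setT (EFin \o (fun z => expR (- (th * b z)))).
Proof.
move=> th0; apply: (@bounded_integrable _ _ _ _ _ 1) => // z.
by have /andP[h1 h2] := exp_neg_itv th0 (b0 z); rewrite ger0_norm.
Qed.

(** Integrate [expR y <= 1 + y + y ^+ 2] at [y = th * (m - b z)], which never
    exceeds [th * m] however large [b z] may be: a second moment suffices, as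
    only the lower tail of [b] matters. *)
Lemma laplace_le_second_moment (m s2 th : R) :
  (\int[nu]_z (b z)%:E = m%:E)%E ->
  (\int[nu]_z (b z ^+ 2)%:E = (s2 + m ^+ 2)%:E)%E ->
  0 < th -> th * m <= 3^-1 ->
  expR (th * m) * \int[nu]_z expR (- (th * b z)) <= 1 + th ^+ 2 * s2.
Proof.
move=> Eb Eb2 th0 thm.
have i1 : nu.-integrable setT (EFin \o b).
  apply/integrableP; split; first exact/measurable_EFinP.
  under eq_integral do rewrite gee0_abs ?lee_fin//.
  by rewrite Eb ltry.
have i2 : nu.-integrable setT (EFin \o (fun z => b z ^+ 2)).
  apply/integrableP; split; first by apply/measurable_EFinP; exact: measurable_funX.
  under eq_integral do rewrite gee0_abs ?lee_fin ?sqr_ge0//.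
  by rewrite Eb2 ltry.
pose c1 := 1 + th * m + th ^+ 2 * m ^+ 2.
pose c2 := - (th + 2 * th ^+ 2 * m).
have ic : nu.-integrable setT (EFin \o (fun=> c1)).
  exact: (@bounded_integrable _ _ _ _ (fun=> c1) `|c1|).
have ib : nu.-integrable setT (EFin \o (fun z => c2 * b z)) by exact: integrableZl i1.
have ib2 : nu.-integrable setT (EFin \o (fun z => th ^+ 2 * b z ^+ 2)).
  exact: integrableZl i2.
have icb : nu.-integrable setT (EFin \o (fun z => c1 + c2 * b z)).
  exact: integrableD ic ib.
rewrite -RintegralZl//; last exact/iexp/ltW.
apply: (@le_trans _ _ (\int[nu]_z (c1 + c2 * b z + th ^+ 2 * b z ^+ 2))).
  apply: le_Rintegral => //.
  - exact: integrableZl (iexp (ltW th0)).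
  - exact: integrableD icb ib2.
  - move=> z _; rewrite -expRD.
    have -> : th * m + - (th * b z) = th * (m - b z) by ring.
    apply: le_trans (expR_le_quadratic _) _; last first.
      by rewrite le_eqVlt /c1 /c2; apply/orP; left; apply/eqP; ring.
    by apply: le_trans thm; rewrite ler_pM2l// gerBl.
rewrite RintegralD// RintegralD// !RintegralZl// Rintegral_cst//=.
rewrite [X in fine X]probability_setT /Rintegral Eb Eb2/= /c1 /c2.
by rewrite le_eqVlt; apply/orP; left; apply/eqP; ring.
Qed.

(** Only a first moment is available here. Truncating [b] keeps a mean above
    [m1] and makes the quadratic term bounded, so that the linear gain wins for
    small [th]. *)
Lemma laplace_drift (L m1 : R) :
  (\int[nu]_z (b z)%:E = L%:E)%E -> 0 <= m1 -> m1 < L ->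
  exists th kappa : R, [/\ 0 < th, 0 < kappa &
    expR (th * m1) * \int[nu]_z expR (- (th * b z)) <= 1 - kappa].
Proof.
move=> Eb m10 m1L.
pose m2 := (m1 + L) / 2.
have [n n0 hn] := @truncated_mean_gt _ _ _ nu b L m2 mb b0 Eb ltac:(rewrite /m2; lra).
pose K := m1 + n + 1.
have K0 : 0 < K by rewrite /K; lra.
have m21 : 0 < m2 - m1 by rewrite /m2; lra.
pose th := Num.min (3^-1 / (m1 + 1)) ((m2 - m1) / (2 * K ^+ 2)).
have th0 : 0 < th.
  by rewrite lt_min !divr_gt0// ?mulr_gt0// ?exprn_gt0//; lra.
have thm1 : th * m1 <= 3^-1.
  have : th <= 3^-1 / (m1 + 1) by rewrite ge_min lexx.
  by rewrite ler_pdivlMr ?ltr_wpDl// => h; have := ltW th0; nra.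
have thK : th * K ^+ 2 <= (m2 - m1) / 2.
  have : th <= (m2 - m1) / (2 * K ^+ 2) by rewrite ge_min lexx orbT.
  rewrite invfM mulrA ler_pdivlMr// exprn_gt0//.
exists th, (th * (m2 - m1) / 2); split => //.
  by rewrite divr_gt0// mulr_gt0.
pose c1 := 1 + th * m1 + th ^+ 2 * K ^+ 2.
have mmin : measurable_fun setT (fun z => Num.min (b z) n) by exact: measurable_minr.
have min_itv z : 0 <= Num.min (b z) n <= n.
  by rewrite le_min b0 n0/= ge_min lexx orbT.
have im : nu.-integrable setT (EFin \o (fun z => Num.min (b z) n)).
  apply: (@bounded_integrable _ _ _ _ _ n) => // z.
  by have /andP[? ?] := min_itv z; rewrite ger0_norm.
have ic : nu.-integrable setT (EFin \o (fun=> c1)).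
  exact: (@bounded_integrable _ _ _ _ (fun=> c1) `|c1|).
have imt : nu.-integrable setT (EFin \o (fun z => (- th) * Num.min (b z) n)).
  exact: integrableZl im.
rewrite -RintegralZl//; last exact/iexp/ltW.
apply: (@le_trans _ _ (\int[nu]_z (c1 + (- th) * Num.min (b z) n))).
  apply: le_Rintegral => //.
  - exact: integrableZl (iexp (ltW th0)).
  - exact: integrableD ic imt.
  - move=> z _; rewrite -expRD.
    have /andP[h1 h2] := min_itv z.
    set b' := Num.min (b z) n in h1 h2 *.
    have b'b : b' <= b z by rewrite ge_min lexx.
    apply: (@le_trans _ _ (expR (th * (m1 - b')))).
      rewrite ler_expR mulrBr lerD2l lerN2 ler_pM2l//.
    apply: le_trans (expR_le_quadratic _) _.
      by apply: le_trans thm1; rewrite ler_pM2l// gerBl.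
    have : (m1 - b') ^+ 2 <= K ^+ 2.
      rewrite -(real_normK (num_real (m1 - b'))) ler_pXn2r ?nnegrE ?(ltW K0)//.
      by rewrite ler_norml /K; apply/andP; split; lra.
    move=> /(ler_wpM2l (sqr_ge0 th)) h; rewrite exprMn /c1; lra.
rewrite RintegralD// RintegralZl// Rintegral_cst//=.
rewrite [X in fine X]probability_setT mulr1 /c1.
set I := \int[nu]_z _ in hn *.
have h1 : th * m2 <= th * I by rewrite ler_pM2l// ltW.
have h2 : th * (th * K ^+ 2) <= th * ((m2 - m1) / 2) by rewrite ler_pM2l.
rewrite expr2; lra.
Qed.

End Rates.

(** * Sample paths of the algorithm *)

(** The part of a run of the algorithm that is a deterministic recursion: [A]
    and [B] are one realization of the arrivals, [M] the matches, and [m] the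
    customer rate. *)
Record threshold_path (R : realType) (m delta U Sbar : R)
    (S C A B M : nat -> R) : Prop := ThresholdPath {
  path_delta_gt0 : 0 < delta;
  path_delta_le : delta <= m / 2;
  path_rate_le : m + delta <= U / 2;
  path_cap : U < Sbar;
  path_servers0 : S 0%N = 0;
  path_customers0 : C 0%N = 0;
  path_serversS : forall t,
    S t.+1 = Num.min (pos_part (S t + A t - M t)) Sbar;
  path_customersS : forall t, C t.+1 = pos_part (C t + B t - M t);
  path_match : forall t, M t =
    if Num.min (S t) (C t) < m - delta then 0
    else if Num.min (S t) (C t) <= U / 2 then m - delta else m + delta;
  path_server_arrivals : forall t, 0 <= A t;
  path_customer_arrivals : forall t, 0 <= B t }.

Section SamplePath.
Context {R : realType}.
Variables (m delta U Sbar : R) (S C A B M : nat -> R).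
Hypothesis path : threshold_path m delta U Sbar S C A B M.

Let params : [/\ 0 < delta, delta <= m / 2, m + delta <= U / 2 & U < Sbar].
Proof. by case: path. Qed.

Let Sbar_ge0 : 0 <= Sbar.
Proof. by have [? ? ? ?] := params; lra. Qed.

Lemma servers_ge0 t : 0 <= S t.
Proof.
case: t => [|t]; first by rewrite (path_servers0 path).
by rewrite (path_serversS path) le_min /pos_part le_max lexx/= Sbar_ge0.
Qed.

Lemma customers_ge0 t : 0 <= C t.
Proof.
case: t => [|t]; first by rewrite (path_customers0 path).
by rewrite (path_customersS path) /pos_part le_max lexx.
Qed.

Lemma match_ge0 t : 0 <= M t.
Proof.
have [d0 dm mU US] := params.
by rewrite (path_match path); do 2?case: ifPn => _; lra.
Qed.

Lemma match_le t : M t <= m + delta.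
Proof.
have [d0 dm mU US] := params.
by rewrite (path_match path); do 2?case: ifPn => _; lra.
Qed.

Lemma match_le_pairs t : M t <= Num.min (S t) (C t).
Proof.
have [d0 dm mU US] := params.
rewrite (path_match path); case: ifPn => [_|].
  by rewrite le_min servers_ge0 customers_ge0.
rewrite -leNgt => h; case: ifPn => //; rewrite -ltNge => h2; lra.
Qed.

Lemma customers_conservation t : C t.+1 = C t + B t - M t.
Proof.
rewrite (path_customersS path) /pos_part max_r//; have := match_le_pairs t.
rewrite le_min => /andP[_ h]; have := path_customer_arrivals path t; lra.
Qed.

Lemma customers_total T : \sum_(0 <= t < T) M t = \sum_(0 <= t < T) B t - C T.
Proof.
elim: T => [|T IH]; first by rewrite !big_nil (path_customers0 path) subr0.
by rewrite !big_nat_recr//= IH customers_conservation; ring.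
Qed.

Definition starved_slots T : R := \sum_(0 <= t < T) (S t <= U / 2)%R%:R.

Definition short_queue_slots T : R := \sum_(0 <= t < T) (C t < m - delta)%R%:R.

(** Before the last slot [tau] in which the queue is at most [U / 2] every
    customer but [U / 2] has been served; after it the service rate is
    [m + delta] except in starved slots, and the slot [tau] itself costs at most
    [m]. Hence the throughput can fall short of [m] only through a deficit of
    arrivals or through starved slots, whether or not the queue is stable. *)
Lemma throughput T : exists2 tau, (tau <= T)%N &
  \sum_(0 <= t < tau) (B t - m) - U / 2 - m
    <= \sum_(0 <= t < T) (M t - m) + m * starved_slots T.
Proof.
have [d0 dm mU US] := params.
elim: T => [|T [tau tauT IH]].
  by exists 0%N => //; rewrite /starved_slots !big_nil; lra.
have starve_ge0 : 0 <= starved_slots T by apply: sumr_ge0 => t _.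
rewrite /starved_slots !big_nat_recr//= -/(starved_slots T).
have [CU|CU] := leP (C T) (U / 2).
  exists T => //.
  have := customers_total T; have := match_ge0 T.
  have : 0 <= (S T <= U / 2)%R%:R :> R by [].
  have e (f : nat -> R) : \sum_(0 <= t < T) (f t - m) = \sum_(0 <= t < T) f t - T%:R * m.
    by rewrite sumrB sumr_const_nat subn0 mulr_natl.
  rewrite !e => h1 h2 h3; nra.
exists tau; first exact: leqW.
have [SU|SU] := leP (S T) (U / 2).
  by have := match_ge0 T; rewrite /= mulr1n; lra.
rewrite /= mulr0n addr0; have -> : M T = m + delta.
  rewrite (path_match path).
  have h : U / 2 < Num.min (S T) (C T) by rewrite lt_min SU CU.
  by rewrite leNgt h/=; case: ifPn => // h2; lra.
lra.
Qed.

(** The potential [expR (- (th * S t))] contracts by the factor [1 - kappa] in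
    mean, except for the term [expR (- (th * U))] that accounts for the cap; in
    a starved slot it is at least [expR (- (th * (U / 2)))]. *)
Lemma starved_slots_le th kappa phi T : 0 < th -> 0 <= kappa ->
  expR (th * (m + delta)) * phi <= 1 - kappa -> 0 <= phi ->
  kappa * expR (- (th * (U / 2))) * starved_slots T <= 1 + expR (- (th * U)) * T%:R
    + \sum_(0 <= t < T) expR (- (th * S t) + th * M t) * (expR (- (th * A t)) - phi).
Proof.
have [d0 dm mU US] := params.
move=> th0 kappa0 drift phi0.
suff : expR (- (th * S T)) + kappa * expR (- (th * (U / 2))) * starved_slots T
    <= 1 + expR (- (th * U)) * T%:R
    + \sum_(0 <= t < T) expR (- (th * S t) + th * M t) * (expR (- (th * A t)) - phi).
  have := expR_ge0 (- (th * S T)); lra.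
elim: T => [|T IH].
  by rewrite /starved_slots !big_nil (path_servers0 path) mulr0 oppr0 expR0; lra.
rewrite /starved_slots !big_nat_recr//= -/(starved_slots T) -natr1.
set Y := expR (- (th * S T)) in IH *.
have step : expR (- (th * S T.+1))
    <= expR (- (th * S T) + th * M T) * expR (- (th * A T)) + expR (- (th * U)).
  rewrite (path_serversS path) -expRD.
  have [h|h] := leP (pos_part (S T + A T - M T)) Sbar.
    apply: (@le_trans _ _ (expR (- (th * S T) + th * M T + - (th * A T)))).
      rewrite ler_expR /pos_part.
      have : S T + A T - M T <= Num.max 0 (S T + A T - M T) by rewrite le_max lexx orbT.
      nra.
    by rewrite lerDl expR_ge0.
  apply: (@le_trans _ _ (expR (- (th * U)))); last by rewrite lerDr expR_ge0.
  by rewrite ler_expR; nra.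
have contract : expR (- (th * S T) + th * M T) * phi
    <= Y - kappa * expR (- (th * (U / 2))) * (S T <= U / 2)%R%:R.
  rewrite expRD -/Y -mulrA.
  have h1 : expR (th * M T) * phi <= 1 - kappa.
    apply: le_trans drift; apply: ler_wpM2r => //.
    by rewrite ler_expR ler_pM2l// match_le.
  apply: (@le_trans _ _ (Y * (1 - kappa))); first by rewrite ler_wpM2l// expR_ge0.
  have kY : kappa * expR (- (th * (U / 2))) * (S T <= U / 2)%R%:R <= kappa * Y;
    last by lra.
  rewrite -mulrA ler_wpM2l//; case: (leP (S T)) => SU.
    by rewrite mulr1 ler_expR lerN2 ler_pM2l.
  by rewrite mulr0 expR_ge0.
lra.
Qed.

(** The potential [expR (- (th * C t))] does not grow in mean while the queue is
    at most [U / 2] and loses the fraction [g] when there is no service; it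
    grows only beyond [U / 2], where it is exponentially small. *)
Lemma short_queue_slots_le th g phi T : 0 < th -> 0 <= g -> 0 <= phi ->
  expR (th * (m - delta)) * phi <= 1 -> phi <= 1 - g ->
  g * expR (- (th * m)) * short_queue_slots T
    <= 1 + (expR (2 * th * delta) - 1) * expR (- (th * (U / 2))) * T%:R
    + \sum_(0 <= t < T) expR (- (th * C t) + th * M t) * (expR (- (th * B t)) - phi).
Proof.
have [d0 dm mU US] := params.
move=> th0 g0 phi0 mid low.
set E := (expR (2 * th * delta) - 1) * expR (- (th * (U / 2))).
have thd : 0 <= 2 * th * delta by rewrite !mulr_ge0// ltW.
have e1 : 1 <= expR (2 * th * delta) by rewrite -[leLHS]expR0 ler_expR.
have E0 : 0 <= E by rewrite mulr_ge0 ?expR_ge0// subr_ge0.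
suff : expR (- (th * C T)) + g * expR (- (th * m)) * short_queue_slots T
    <= 1 + E * T%:R
    + \sum_(0 <= t < T) expR (- (th * C t) + th * M t) * (expR (- (th * B t)) - phi).
  have := expR_ge0 (- (th * C T)); lra.
elim: T => [|T IH].
  by rewrite /short_queue_slots !big_nil (path_customers0 path) mulr0 oppr0 expR0; lra.
rewrite /short_queue_slots !big_nat_recr//= -/(short_queue_slots T) -natr1.
set Y := expR (- (th * C T)) in IH *.
have Y0 : 0 <= Y by exact: expR_ge0.
have step : expR (- (th * C T.+1))
    = expR (- (th * C T) + th * M T) * expR (- (th * B T)).
  by rewrite customers_conservation -expRD; congr expR; ring.
have contract : expR (- (th * C T) + th * M T) * phi
    <= Y - g * expR (- (th * m)) * (C T < m - delta)%R%:R + E.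
  rewrite expRD -/Y -mulrA.
  have [CT|CT] := ltP (C T) (m - delta).
    have -> : M T = 0 by rewrite (path_match path) gt_min CT orbT.
    rewrite mulr0 expR0 mul1r mulr1.
    have h1 : Y * phi <= Y * (1 - g) by rewrite ler_wpM2l.
    have h2 : g * expR (- (th * m)) <= g * Y.
      by rewrite ler_wpM2l// ler_expR lerN2 ler_pM2l//; lra.
    lra.
  rewrite mulr0 subr0.
  have [CU|CU] := leP (C T) (U / 2).
    have ML : M T <= m - delta.
      by rewrite (path_match path); case: ifPn => _; [lra|rewrite ge_min CU orbT].
    have h1 : expR (th * M T) * phi <= 1.
      by apply: le_trans mid; apply: ler_wpM2r => //; rewrite ler_expR ler_pM2l.
    have := ler_wpM2l Y0 h1; lra.
  have h1 : expR (th * M T) * phi <= expR (2 * th * delta).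
    apply: (@le_trans _ _ (expR (2 * th * delta) * (expR (th * (m - delta)) * phi))).
      rewrite mulrA -expRD; apply: ler_wpM2r => //; rewrite ler_expR.
      have := match_le T; nra.
    by rewrite ler_piMr// expR_ge0.
  have h2 : Y <= expR (- (th * (U / 2))) by rewrite ler_expR lerN2 ler_pM2l// ltW.
  have h3 := ler_wpM2l Y0 h1.
  have h4 : (expR (2 * th * delta) - 1) * Y <= E by rewrite ler_wpM2l// subr_ge0.
  lra.
lra.
Qed.

(** A slot without service, with [V 0] far from the tangent, is short of
    customers or of servers; in every other slot the second-order expansion
    applies. *)
Lemma total_value_ge (V : R -> R) (p a L dV c0 : R) T :
  0 <= p -> 0 <= L -> p * delta < dV ->
  (forall h, `|h| < dV -> `|V (p * m + h) - V (p * m) - a * h| <= L * h ^+ 2) ->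
  0 <= c0 -> V (p * m) - a * (p * m) - c0 <= V 0 ->
  T%:R * V (p * m) + a * p * (\sum_(0 <= t < T) (M t - m))
    - T%:R * (L * (p * delta) ^+ 2) - c0 * (short_queue_slots T + starved_slots T)
  <= \sum_(0 <= t < T) V (p * M t).
Proof.
have [d0 dm mU US] := params.
move=> p0 L0 pd Vq c00 V0.
elim: T => [|T IH].
  by rewrite /short_queue_slots /starved_slots !big_nil; lra.
rewrite /short_queue_slots /starved_slots !big_nat_recr//=.
rewrite -/(starved_slots T) -/(short_queue_slots T) -natr1.
suff : V (p * m) + a * p * (M T - m) - L * (p * delta) ^+ 2
    - c0 * ((C T < m - delta)%R%:R + (S T <= U / 2)%R%:R) <= V (p * M T) by lra.
have pd0 : 0 <= p * delta by rewrite mulr_ge0// ltW.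
have ind0 (x : bool) : 0 <= c0 * x%:R by rewrite mulr_ge0.
have Lp0 : 0 <= L * (p * delta) ^+ 2 by rewrite mulr_ge0// sqr_ge0.
rewrite (path_match path); case: ifPn => [|_].
  rewrite gt_min => low.
  have : 1 <= (C T < m - delta)%R%:R + (S T <= U / 2)%R%:R :> R.
    case/orP: low => h; last by rewrite h lerDl.
    have -> : S T <= U / 2 by lra.
    by rewrite lerDr.
  move=> /(ler_wpM2l c00); rewrite mulr0; lra.
have key h : `|h| = p * delta -> forall y, p * y = p * m + h ->
    V (p * m) + a * (p * (y - m)) - L * (p * delta) ^+ 2 <= V (p * y).
  move=> hE y yE; rewrite yE; have := Vq h; rewrite hE => /(_ pd).
  rewrite -(real_normK (num_real h)) hE ler_norml => /andP[+ _].
  move=> h1; suff -> : p * (y - m) = h by lra.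
  by rewrite mulrBr yE addrC addKr.
have i1 := ind0 (C T < m - delta)%R; have i2 := ind0 (S T <= U / 2)%R.
case: ifPn => _.
  have := key (- (p * delta)) _ (m - delta) _; rewrite normrN ger0_norm//.
  move=> /(_ erefl ltac:(ring)); lra.
have := key (p * delta) _ (m + delta) _; rewrite ger0_norm//.
move=> /(_ erefl ltac:(ring)); lra.
Qed.

End SamplePath.

(** * Long-run averages under the algorithm *)

Section Averages.
Context {R : realType}.

Lemma sublinear_affine (u : nat -> R) e : sublinear u -> 0 < e ->
  exists K, forall n, `|u n| <= K + e * n%:R.
Proof.
move=> su e0; have [N hN] := su e e0.
exists (\sum_(0 <= k < N) `|u k|) => n.
have [Nn|nN] := leqP N n.
  by apply: le_trans (hN n Nn) _; rewrite lerDr; exact: sumr_ge0.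
rewrite big_mkord (bigD1 (Ordinal nN))//= -addrA lerDl addr_ge0//.
  exact: sumr_ge0.
by rewrite mulr_ge0// ltW.
Qed.

Lemma limn_einf_average_ge (s : nat -> R) (l K : R) :
  (forall n, n%:R * l - K <= s n) ->
  (l%:E <= limn_einf (fun n => (n%:R^-1 * s n)%:E))%E.
Proof.
move=> ls.
apply/lee_addgt0Pr => e e0; rewrite -leeBlDr// -EFinB.
rewrite -[X in (X <= _)%E](limn_einf_cst (_ : \bar R)).
apply: (@le_limn_einf _ _ _ (Num.truncn (`|K| / e)).+1) => n Nn; rewrite lee_fin.
have Kn : `|K| / e < n%:R by apply: lt_le_trans (truncnS_gt _) _; rewrite ler_nat.
have n0 : 0 < n%:R :> R by rewrite ltr0n; exact: leq_ltn_trans Nn.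
rewrite ler_pdivlMl// mulrBr; apply: le_trans (ls n); rewrite lerD2l lerN2.
apply: (le_trans (ler_norm K)).
by move: Kn; rewrite ltr_pdivrMr// => /ltW.
Qed.

End Averages.

Section Algorithm.
Context (R : realType) (D : set R) (lambda : R) (mu : R -> R)
  (arr : R.-pker R ~> (R * R)%type) (Sbar : R) d (Omega : measurableType d)
  (P : probability Omega R) (X : process R Omega) (pstar delta U : R).
Hypotheses (arrP : arrival_model D lambda mu arr) (Dp : D pstar)
  (admX : admissible P D arr Sbar X)
  (runX : runs_algorithm pstar (mu pstar) delta U X).
Notation nu := (slot_law arr pstar).
Let m := mu pstar.
Hypotheses (delta_gt0 : 0 < delta) (delta_lt : delta <= m / 2)
  (m_le : m + delta <= U / 2) (U_lt : U < Sbar).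

Lemma algorithm_path w : threshold_path m delta U Sbar
  (fun t => servers X t w) (fun t => customers X t w)
  (fun t => server_arrivals X t w) (fun t => customer_arrivals X t w)
  (fun t => num_matched X t w).
Proof.
have [_ _ pos /(_ w)[S0 C0 SS CS] _] := admX.
have [_ M_def _] := runX.
by split=> // t; have [] := pos t w.
Qed.

Let price_cst t w : price X t w = pstar.
Proof. by have [] := runX. Qed.

Let M_known t : measurable_fun setT
  (num_matched X t : g_sigma_algebraType (history X t) -> R).
Proof.
rewrite (_ : num_matched X t = fun w =>
  if Num.min (servers X t w) (customers X t w) < m - delta then 0
  else if Num.min (servers X t w) (customers X t w) <= U / 2 then m - delta
  else m + delta); last by apply/funext => w; exact: path_match (algorithm_path w) t.
have mN : measurable_fun setT ((fun w => Num.min (servers X t w) (customers X t w))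
    : g_sigma_algebraType (history X t) -> R).
  apply: measurable_minr; [exact: (@servers_known _ _ _ _ _ _ _ _ admX t)|].
  exact: (@customers_known _ _ _ _ _ _ _ _ admX t).
apply: measurable_fun_ifT => //; first exact: measurable_fun_ltr.
by apply: measurable_fun_ifT => //; exact: measurable_fun_ler.
Qed.

Let weight_known th (Q : nat -> Omega -> R) t :
  measurable_fun setT (Q t : g_sigma_algebraType (history X t) -> R) ->
  measurable_fun setT ((fun w => expR (- (th * Q t w) + th * num_matched X t w))
    : g_sigma_algebraType (history X t) -> R).
Proof.
move=> mQ; apply: measurableT_comp => //; apply: measurable_funD.
  by apply: measurableT_comp => //; exact: measurable_funM.
by apply: measurable_funM => //; exact: (@M_known t).
Qed.

Let weight_le th q t w : 0 < th -> 0 <= q ->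
  `|expR (- (th * q) + th * num_matched X t w)| <= expR (th * (m + delta)).
Proof.
move=> th0 q0; rewrite ger0_norm ?expR_ge0// ler_expR.
have h1 := match_le (algorithm_path w) t.
have : th * num_matched X t w <= th * (m + delta) by rewrite ler_pM2l.
have : 0 <= th * q by rewrite mulr_ge0// ltW.
lra.
Qed.

Let max_server : measurable_fun setT (fun z : R * R => Num.max 0 z.1).
Proof. by apply: measurable_maxr => //; exact: measurable_fst. Qed.

Let max_customer : measurable_fun setT (fun z : R * R => Num.max 0 z.2).
Proof. by apply: measurable_maxr => //; exact: measurable_snd. Qed.

Let max_ge0 (x : R) : 0 <= Num.max 0 x.
Proof. by rewrite le_max lexx. Qed.

Lemma starved_slots_frequency th kappa r : 0 < th -> 0 < kappa -> 0 < r ->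
  expR (th * (m + delta)) * \int[nu]_z expR (- (th * Num.max 0 z.1)) <= 1 - kappa ->
  {ae P, forall w, exists K, forall T,
    starved_slots U (fun t => servers X t w) T
      <= K + T%:R * (expR (- (th * (U / 2))) / kappa + r)}.
Proof.
move=> th0 k0 r0 drift.
set phi := \int[nu]_z _ in drift.
have phi0 : 0 <= phi by apply: Rintegral_ge0 => z _; exact: expR_ge0.
have e0 : 0 < kappa * expR (- (th * (U / 2))) * r.
  by rewrite !mulr_gt0// expR_gt0.
have weight_F t := weight_known th
  (@servers_known _ _ _ _ _ _ _ _ admX t).
have weight_bd t w := weight_le t w th0 (servers_ge0 (algorithm_path w) t).
have meas_exp : measurable_fun setT (fun z : R * R => expR (- (th * Num.max 0 z.1))).
  apply: measurableT_comp => //; apply: measurableT_comp => //.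
  by apply: measurable_funM => //; exact: max_server.
have exp_bd (z : R * R) := exp_neg_itv (ltW th0) (max_ge0 z.1).
apply: filterS (strong_law_innovations admX price_cst weight_F weight_bd
  meas_exp exp_bd).
move=> w /sublinear_affine/(_ e0)[K hK].
exists ((1 + K) / (kappa * expR (- (th * (U / 2))))) => T.
have := starved_slots_le (algorithm_path w) T th0 (ltW k0) drift phi0.
have := hK T; rewrite -/phi ler_norml => /andP[_].
have -> : expR (- (th * U)) = expR (- (th * (U / 2))) * expR (- (th * (U / 2))).
  by rewrite -expRD; congr expR; lra.
under eq_bigr => t _.
  have -> : Num.max 0 (arrivals X t w).1 = server_arrivals X t w.
    by rewrite max_r//; exact: path_server_arrivals (algorithm_path w) t.
  over.
set E := expR (- (th * (U / 2))) in e0 *.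
have E0 : 0 < E by exact: expR_gt0.
set Sg := \sum_(0 <= t < T) _ => h1 h2.
have kE : 0 < kappa * E by exact: mulr_gt0.
rewrite -(ler_pM2l kE).
have -> : kappa * E * ((1 + K) / (kappa * E) + T%:R * (E / kappa + r))
    = 1 + K + T%:R * (E * E + kappa * E * r).
  by field; rewrite !gt_eqF.
lra.
Qed.

Lemma short_queue_slots_frequency th g r : 0 < th -> 0 < g -> 0 < r ->
  let phi := \int[nu]_z expR (- (th * Num.max 0 z.2)) in
  expR (th * (m - delta)) * phi <= 1 -> phi <= 1 - g ->
  {ae P, forall w, exists K, forall T,
    short_queue_slots m delta (fun t => customers X t w) T
      <= K + T%:R * ((expR (2 * th * delta) - 1) * expR (- (th * (U / 2)))
                     / (g * expR (- (th * m))) + r)}.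
Proof.
move=> th0 g0 r0 phi mid low.
have phi0 : 0 <= phi by apply: Rintegral_ge0 => z _; exact: expR_ge0.
have kE : 0 < g * expR (- (th * m)) by rewrite mulr_gt0// expR_gt0.
have e0 : 0 < g * expR (- (th * m)) * r by rewrite mulr_gt0.
have weight_F t := weight_known th
  (@customers_known _ _ _ _ _ _ _ _ admX t).
have weight_bd t w := weight_le t w th0 (customers_ge0 (algorithm_path w) t).
have meas_exp : measurable_fun setT (fun z : R * R => expR (- (th * Num.max 0 z.2))).
  apply: measurableT_comp => //; apply: measurableT_comp => //.
  by apply: measurable_funM => //; exact: max_customer.
have exp_bd (z : R * R) := exp_neg_itv (ltW th0) (max_ge0 z.2).
apply: filterS (strong_law_innovations admX price_cst weight_F weight_bd
  meas_exp exp_bd).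
move=> w /sublinear_affine/(_ e0)[K hK].
exists ((1 + K) / (g * expR (- (th * m)))) => T.
have := short_queue_slots_le (algorithm_path w) T th0 (ltW g0) phi0 mid low.
have := hK T; rewrite -/phi ler_norml => /andP[_].
under eq_bigr => t _.
  have -> : Num.max 0 (arrivals X t w).2 = customer_arrivals X t w.
    by rewrite max_r//; exact: path_customer_arrivals (algorithm_path w) t.
  over.
set E := (expR (2 * th * delta) - 1) * _.
set G := g * _ in kE e0 *.
set Sg := \sum_(0 <= t < T) _ => h1 h2.
rewrite -(ler_pM2l kE).
have -> : G * ((1 + K) / G + T%:R * (E / G + r)) = 1 + K + T%:R * (E + G * r).
  by field; rewrite gt_eqF.
lra.
Qed.

Lemma arrivals_frequency r : 0 < r ->
  {ae P, forall w, exists K, forall T,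
    - (K + T%:R * r) <= \sum_(0 <= t < T) (customer_arrivals X t w - m)}.
Proof.
move=> r0; have r20 : 0 < r / 2 by lra.
have below : m - r / 2 < m by lra.
have [n n0 hn] := truncated_mean_gt (nu := nu) max_customer
  (fun z => max_ge0 z.2) (slot_mean_customers arrP Dp) below.
have one_F t : measurable_fun setT ((fun=> 1)
    : g_sigma_algebraType (history X t) -> R) by exact: measurable_cst.
have one_bd (t : nat) (w : Omega) : `|1 : R| <= 1 by rewrite normr1.
have meas_min : measurable_fun setT (fun z : R * R => Num.min (Num.max 0 z.2) n).
  by apply: measurable_minr => //; exact: max_customer.
have min_bd (z : R * R) : 0 <= Num.min (Num.max 0 z.2) n <= n.
  by rewrite le_min max_ge0 n0/= ge_min lexx orbT.
apply: filterS (strong_law_innovations admX price_cst one_F one_bd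
  meas_min min_bd).
move=> w /sublinear_affine/(_ r20)[K hK]; exists K => T.
have := hK T; rewrite ler_norml => /andP[h _].
set I := \int[nu]_z _ in hn h.
apply: (@le_trans _ _ (\sum_(0 <= t < T)
    ((Num.min (Num.max 0 (arrivals X t w).2) n - I) - r / 2))).
  rewrite sumrB sumr_const_nat subn0 -[(r / 2) *+ T]mulr_natl.
  move: h; under eq_bigr do rewrite mul1r.
  move=> h; rewrite [leLHS](_ : _ = - (K + r / 2 * T%:R) - T%:R * (r / 2)).
    by rewrite lerD2r.
  by field.
apply: ler_sum => t _.
have : Num.min (Num.max 0 (arrivals X t w).2) n <= customer_arrivals X t w.
  rewrite max_r ?ge_min ?lexx//; exact: path_customer_arrivals (algorithm_path w) t.
by move=> h'; rewrite -addrA lerD// -opprD lerN2 -lerBlDr ltW.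
Qed.

(** The loss with respect to [V (pstar * m)] splits into the first-order loss of
    throughput, the second-order loss due to the two service rates, and the
    slots without service. *)
Theorem algorithm_profit_ge (V : R -> R) (a L dV c0 th kappa th' g r q1 q2 : R) :
  let phi := \int[nu]_z expR (- (th' * Num.max 0 z.2)) in
  0 <= pstar -> 0 <= a -> 0 <= L -> pstar * delta < dV ->
  (forall h, `|h| < dV ->
     `|V (pstar * m + h) - V (pstar * m) - a * h| <= L * h ^+ 2) ->
  0 <= c0 -> V (pstar * m) - a * (pstar * m) - c0 <= V 0 ->
  0 < th -> 0 < kappa ->
  expR (th * (m + delta)) * \int[nu]_z expR (- (th * Num.max 0 z.1)) <= 1 - kappa ->
  0 < th' -> 0 < g -> expR (th' * (m - delta)) * phi <= 1 -> phi <= 1 - g ->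
  0 < r -> expR (- (th * (U / 2))) / kappa + r <= q1 ->
  (expR (2 * th' * delta) - 1) * expR (- (th' * (U / 2)))
    / (g * expR (- (th' * m))) + r <= q2 ->
  {ae P, forall w, ((V (pstar * m) - (a * pstar * (m * q1 + r)
     + L * (pstar * delta) ^+ 2 + c0 * (q1 + q2)))%:E <= profit V X w)%E}.
Proof.
move=> phi p0 a0 L0 pd Vq c00 V0 th0 k0 drift th'0 g0 mid low r0 q1P q2P.
have m0 : 0 <= m by have := delta_lt; have := delta_gt0; lra.
apply: filterS3 (starved_slots_frequency th0 k0 r0 drift)
  (short_queue_slots_frequency th'0 g0 r0 mid low) (arrivals_frequency r0).
move=> w [K1 h1] [K2 h2] [K3 h3].
apply: (@limn_einf_average_ge _ _ _
  (a * pstar * (K3 + U / 2 + m + m * K1) + c0 * (K1 + K2))) => T.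
have revE t : revenue X t w = pstar * num_matched X t w.
  rewrite /revenue /num_matched mulr_sumr; apply: eq_bigr => s _.
  by rewrite price_cst.
under eq_bigr do rewrite revE.
apply: le_trans (total_value_ge (algorithm_path w) T p0 L0 pd Vq c00 V0).
have {}h1 : starved_slots U (fun t => servers X t w) T <= K1 + T%:R * q1.
  by apply: (le_trans (h1 T)); rewrite lerD2l ler_wpM2l.
have {}h2 : short_queue_slots m delta (fun t => customers X t w) T <= K2 + T%:R * q2.
  by apply: (le_trans (h2 T)); rewrite lerD2l ler_wpM2l.
have [tau tauT h4] := throughput (algorithm_path w) T.
have h5 : - (K3 + T%:R * r) <= \sum_(0 <= t < tau) (customer_arrivals X t w - m).
  apply: le_trans (h3 tau); rewrite lerN2 lerD2l ler_wpM2r ?ler_nat//.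
  exact: ltW.
have ap0 : 0 <= a * pstar by exact: mulr_ge0.
move: h1 h2 h4 h5.
set st := starved_slots _ _ _; set sh := short_queue_slots _ _ _ _.
set G := \sum_(0 <= t < T) _; set W := \sum_(0 <= t < tau) _.
move=> h1 h2 h4 h5.
have h6 : - (K3 + T%:R * r) - U / 2 - m - m * (K1 + T%:R * q1) <= G.
  have := ler_wpM2l m0 h1; lra.
have h7 := ler_wpM2l ap0 h6.
have h8 := ler_wpM2l c00 (lerD h1 h2).
lra.
Qed.

End Algorithm.

(** * Choice of the constants *)

Section Degenerate.
Context (R : realType) (D : set R) (arr : R.-pker R ~> (R * R)%type)
  (Sbar : R) d (Omega : measurableType d)
  (P : probability Omega R) (X : process R Omega) (pstar m delta U : R).

(** In the empty system of slot [0] the algorithm with [m <= 0] would have to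
    match the negative amount [m - delta]. *)
Lemma algorithm_rate_gt0 : 0 < delta -> 0 < U ->
  admissible P D arr Sbar X -> runs_algorithm pstar m delta U X -> 0 < m.
Proof.
move=> delta0 U0 [_ _ _ dyn feas] [_ /(_ 0%N point) M0 _].
rewrite ltNge; apply/negP => m0.
have [S0 C0 _ _] := dyn point; have [matched0 _ _] := feas point.
have : 0 <= num_matched X 0 point by apply: sumr_ge0.
rewrite M0 /num_pairs S0 C0 minxx ltNge.
have -> : m - delta <= 0 by lra.
have -> : 0 <= U / 2 by lra.
rewrite /=; lra.
Qed.

End Degenerate.

Section Tuning.
Context {R : realType}.

Lemma expR_neg_le (x : R) : 0 < x -> expR (- x) <= 2 / x ^+ 2.
Proof.
move=> x0; have := expR_ge1Dxn 1 (ltW x0); rewrite expRN => h.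
have x2 : 0 < x ^+ 2 / 2 by rewrite divr_gt0// exprn_gt0.
rewrite -[leRHS]invf_div lef_pV2 ?posrE ?expR_gt0//.
by apply: le_trans h; rewrite lerDr.
Qed.

(** The exponent [delta / s2] is half of the decay rate of the queue at drift
    [delta]. It makes [th ^+ 2 * s2] equal to [th * delta], which the drift
    [delta] offsets exactly. *)
Lemma short_queue_tuning (m s2 th delta phi : R) : 0 < m -> 0 < s2 -> 0 < delta ->
  delta <= m / 2 -> th = delta / s2 -> th * m <= 3^-1 ->
  expR (th * m) * phi <= 1 + th ^+ 2 * s2 ->
  expR (th * (m - delta)) * phi <= 1 /\ phi <= 1 - th * m / 4.
Proof.
move=> m0 s0 d0 dm thE thm lap.
have th0 : 0 < th by rewrite thE divr_gt0.
have ths : th * s2 = delta by rewrite thE divfK// gt_eqF.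
have mid : expR (th * (m - delta)) * phi <= 1.
  have -> : th * (m - delta) = - (th * delta) + th * m by ring.
  rewrite expRD -mulrA expRN ler_pdivrMl ?expR_gt0// mulr1.
  apply: (le_trans lap); rewrite expr2 -mulrA ths; exact: expR_ge1Dx.
split=> //.
have -> : phi = expR (- (th * (m - delta))) * (expR (th * (m - delta)) * phi).
  by rewrite mulrA -expRD addNr expR0 mul1r.
apply: (@le_trans _ _ (expR (- (th * m / 2)))).
  apply: (@le_trans _ _ (expR (- (th * (m - delta))))).
    by rewrite ler_piMr ?expR_ge0.
  by rewrite ler_expR lerN2 -mulrA ler_pM2l//; lra.
have tm0 : 0 < th * m by rewrite mulr_gt0.
apply: le_trans (expR_le_quadratic _) _; nra.
Qed.

Lemma starved_tuning (th kappa U r : R) :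
  0 < th -> 0 < kappa -> 0 < U -> U ^- 2 <= r ->
  expR (- (th * (U / 2))) / kappa + r <= (8 / (th ^+ 2 * kappa) + 1) * r.
Proof.
move=> th0 k0 U0 rU.
have h1 : expR (- (th * (U / 2))) <= 2 / (th * (U / 2)) ^+ 2.
  by apply: expR_neg_le; rewrite mulr_gt0// divr_gt0.
have h2 : 2 / (th * (U / 2)) ^+ 2 / kappa = 8 / (th ^+ 2 * kappa) * U ^- 2.
  by field; rewrite !gt_eqF.
have h3 : 0 <= 8 / (th ^+ 2 * kappa) by rewrite divr_ge0// mulr_ge0 ?sqr_ge0 ?ltW.
rewrite mulrDl mul1r lerD2r.
by apply: le_trans (ler_wpM2l h3 rU); rewrite -h2 ler_pM2r// invr_gt0.
Qed.

(** With this exponent [expR (- (th * (U / 2)))] is only [U] to the power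
    [- beta / 2], at most [U^-1]. The missing factor comes from the growth of
    the potential beyond [U / 2], which is [O (th * delta)], against a loss of
    order [th] without service: the quotient contributes [delta]. *)
Lemma short_queue_frequency_tuning (m s2 beta U th delta : R) :
  0 < m -> 0 < s2 -> 2 <= beta -> 0 < U -> 1 <= ln U ->
  delta = beta * s2 * (ln U / U) -> 0 < delta -> delta <= m / 2 ->
  th = delta / s2 -> th * m <= 3^-1 ->
  (expR (2 * th * delta) - 1) * expR (- (th * (U / 2)))
    / (th * m / 4 * expR (- (th * m))) + (ln U / U) ^+ 2
  <= (32 * (beta * s2) / m + 1) * (ln U / U) ^+ 2.
Proof.
move=> m0 s0 beta2 U0 lnU1 deltaE d0 dm thE thm.
have th0 : 0 < th by rewrite thE divr_gt0.
have b0 : 0 < beta by lra.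
have bs0 : 0 < beta * s2 by exact: mulr_gt0.
have thd : 0 <= 2 * th * delta.
  by apply: mulr_ge0; [apply: mulr_ge0 => //; exact: ltW|exact: ltW].
have thd_le : 2 * th * delta <= th * m by have := ler_wpM2l (ltW th0) dm; lra.
have e1 : expR (2 * th * delta) - 1 <= 4 * th * delta.
  have := expR_le_quadratic (le_trans thd_le thm); nra.
have e2 : expR (- (th * (U / 2))) <= U^-1.
  have -> : U^-1 = expR (- ln U) by rewrite expRN lnK.
  rewrite ler_expR lerN2.
  have -> : th * (U / 2) = beta / 2 * ln U.
    by rewrite thE deltaE; field; rewrite !gt_eqF.
  by rewrite ler_peMl; lra.
have e3 : expR (th * m) <= 2 by have := expR_le_quadratic thm; nra.
have e4 : 1 <= expR (2 * th * delta) by rewrite -[leLHS]expR0 ler_expR.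
rewrite [leRHS]mulrDl mul1r lerD2r invfM.
have -> : (expR (- (th * m)))^-1 = expR (th * m) by rewrite expRN invrK.
apply: (@le_trans _ _ ((4 * th * delta) * U^-1 * ((th * m / 4)^-1 * 2))).
  have g0 : 0 < (th * m / 4)^-1 by rewrite invr_gt0 divr_gt0// mulr_gt0.
  apply: ler_pM.
  - by rewrite mulr_ge0 ?expR_ge0// subr_ge0.
  - by rewrite mulr_ge0 ?expR_ge0// ltW.
  - by apply: ler_pM; rewrite ?expR_ge0// subr_ge0.
  - by rewrite ler_pM2l.
have -> : (4 * th * delta) * U^-1 * ((th * m / 4)^-1 * 2)
    = 32 * (beta * s2) / m * (ln U * U ^- 2).
  by rewrite thE deltaE; field; rewrite !gt_eqF//; lra.
rewrite ler_wpM2l//; first by rewrite divr_ge0 ?(ltW m0)// mulr_ge0 ?(ltW bs0).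
rewrite expr_div_n ler_pM2r ?invr_gt0 ?exprn_gt0//.
by rewrite expr2 ler_peMr//; lra.
Qed.

End Tuning.


(** * The optimality gap *)

Theorem theorem10 (R : realType) (D : set R) (lambda : R) (mu : R -> R)
    (arr : R.-pker R ~> (R * R)%type) (V : R -> R) (pstar sigma2 beta : R)
    (D_itv : is_interval D)
    (D_ge0 : forall p, D p -> 0 <= p)
    (arrP : arrival_model D lambda mu arr)
    (mu_noninc : forall p q, D p -> D q -> p <= q -> mu q <= mu p)
    (mu_cont : {within D, continuous mu})
    (mu_concave : concave_on D mu)
    (pmu_unimodal : unimodal_on D (fun p => p * mu p))
    (V_nondec : forall x y, 0 <= x -> x <= y -> V x <= V y)
    (V_concave : concave_on [set x | 0 <= x] V)
    (pstarP : is_argmax_price D lambda mu pstar)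
    (V_smooth : twice_differentiable_at V (pstar * mu pstar))
    (lambda_gt : mu pstar < lambda)
    (beta_ge2 : 2 <= beta) :
  exists K U0 : R, forall U Sbar : R, U0 <= U -> 0 < U -> U < Sbar ->
    let delta := beta * sigma2 * (ln U / U) in 0 < delta ->
    forall (d : measure_display) (Omega : measurableType d)
      (P : probability Omega R) (X : process R Omega),
      admissible P D arr Sbar X ->
      runs_algorithm pstar (mu pstar) delta U X ->
      customer_variance_rate P X sigma2 ->
      {ae P, forall w : Omega,
        (optimal_profit D arr Sbar V - (K * (ln U / U) ^+ 2)%:E
           <= profit V X w)%E}.
Proof.
have [Dp _ _] := pstarP; have p0 := D_ge0 _ Dp.
set m := mu pstar in lambda_gt V_smooth *.
have m_ge0 : 0 <= m := customer_rate_ge0 arrP Dp.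
have x00 : 0 <= pstar * m by exact: mulr_ge0.
have dV : derivable V (pstar * m) 1 by have [/nbhs_singleton] := V_smooth.
have a0 := derive1_ge0_right V_nondec x00 dV.
set a := derive1 V (pstar * m) in a0.
have V_le y : 0 <= y -> V y <= V (pstar * m) - a * (pstar * m) + a * y.
  by move=> y0; have := concave_tangent V_concave x00 dV y0; rewrite -/a; lra.
have opt_le Sbar : (optimal_profit D arr Sbar V <= (V (pstar * m))%:E)%E.
  have := optimal_profit_le D_ge0 arrP (revenue_rate_le_argmax D_itv D_ge0
    mu_noninc mu_cont mu_concave pstarP lambda_gt) V_nondec a0 V_le Sbar.
  by rewrite subrK.
(* If [m <= 0] the algorithm has no run; if [sigma2 <= 0] then [delta <= 0]. *)
have [m0|m0] := ltP 0 m; last first.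
  exists 0, 1 => U Sbar _ U_gt0 _ delta delta0 d Omega P X admX runX _.
  by have := algorithm_rate_gt0 delta0 U_gt0 admX runX; rewrite ltNge m0.
have [s0|s0] := ltP 0 sigma2; last first.
  exists 0, 1 => U Sbar U1 U_gt0 _ delta.
  suff : delta <= 0 by rewrite leNgt => /negbTE ->.
  rewrite /delta mulr_le0_ge0//; last by rewrite divr_ge0 ?ln_ge0// ltW.
  by rewrite mulr_ge0_le0//; lra.
have [L [dV0 [L0 dV00 Vq]]] := twice_differentiable_second_order V_smooth.
have mserver : measurable_fun setT (fun z : R * R => Num.max 0 z.1).
  by apply: measurable_maxr => //; exact: measurable_fst.
have mcustomer : measurable_fun setT (fun z : R * R => Num.max 0 z.2).
  by apply: measurable_maxr => //; exact: measurable_snd.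
have max0 (x : R) : 0 <= Num.max 0 x by rewrite le_max lexx.
have m1_ge0 : 0 <= (m + lambda) / 2 by lra.
have m1_lt : (m + lambda) / 2 < lambda by lra.
have [th [kappa [th0 k0 drift]]] := laplace_drift (nu := slot_law arr pstar)
  mserver (fun z => max0 z.1) (slot_mean_servers arrP Dp) m1_ge0 m1_lt.
have b0 : 0 < beta by lra.
have bs0 : 0 < beta * sigma2 by exact: mulr_gt0.
(* The four bounds keep [m + delta] below [U / 2] and the service rate below
   [(m + lambda) / 2], the revenue within reach of the second-order expansion,
   and [th' * m] below [3^-1]. *)
pose d0 := Num.min (Num.min (m / 2) ((lambda - m) / 2))
  (Num.min (dV0 / (2 * (pstar + 1))) (sigma2 / (3 * m))).
have p10 : 0 < pstar + 1 by lra.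
have d00 : 0 < d0.
  by rewrite !lt_min !divr_gt0 ?mulr_gt0//; lra.
have [U1 U14 hU1] := ln_div_small (divr_gt0 d00 bs0).
pose K1 := 8 / (th ^+ 2 * kappa) + 1.
pose K2 := 32 * (beta * sigma2) / m + 1.
pose c0 := V (pstar * m) - a * (pstar * m) - V 0.
have c00 : 0 <= c0 by have := V_le 0 (lexx 0); rewrite /c0; lra.
exists (a * pstar * (m * K1 + 1) + L * (pstar * (beta * sigma2)) ^+ 2 + c0 * (K1 + K2)).
exists (U1 + 3 * m) => U Sbar U0U U_gt0 USbar delta delta0 d Omega P X admX runX varX.
have U1U : U1 <= U by lra.
have [lnU1 lnUd] := hU1 U U1U.
set r := (ln U / U) ^+ 2.
have r0 : 0 < r by rewrite exprn_gt0// divr_gt0//; lra.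
have delta_d0 : delta <= d0.
  by move: lnUd; rewrite ler_pdivlMr// mulrC.
move: (delta_d0); rewrite !le_min => /andP[/andP[dm dl] /andP[dp dth]].
have mU : m + delta <= U / 2 by lra.
have pd : pstar * delta < dV0.
  move: dp; rewrite ler_pdivlMr ?mulr_gt0//; nra.
pose th' := delta / sigma2.
have th'0 : 0 < th' by rewrite divr_gt0.
have thm : th' * m <= 3^-1.
  rewrite /th' mulrAC ler_pdivrMr//; move: dth; rewrite ler_pdivlMr ?mulr_gt0//; lra.
have lap := laplace_le_second_moment (nu := slot_law arr pstar) mcustomer
  (fun z => max0 z.2) (slot_mean_customers arrP Dp)
  (customer_second_moment arrP Dp admX (let: And3 h _ _ := runX in h) varX)
  th'0 thm.
have [mid low] := short_queue_tuning m0 s0 delta0 dm erefl thm lap.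
have g0 : 0 < th' * m / 4 by rewrite divr_gt0// mulr_gt0.
have drift' : expR (th * (m + delta))
    * \int[slot_law arr pstar]_z expR (- (th * Num.max 0 z.1)) <= 1 - kappa.
  apply: le_trans drift; apply: ler_wpM2r.
    by apply: Rintegral_ge0 => z _; exact: expR_ge0.
  by rewrite ler_expR ler_pM2l//; lra.
have rU : U ^- 2 <= r.
  rewrite /r expr_div_n -[leLHS]mul1r ler_pM2r ?invr_gt0 ?exprn_gt0//.
  exact: exprn_ege1.
have q1P : _ <= K1 * r := starved_tuning th0 k0 U_gt0 rU.
have q2P : _ <= K2 * r := short_queue_frequency_tuning m0 s0 beta_ge2 U_gt0 lnU1
  erefl delta0 dm erefl thm.
have V0 : V (pstar * m) - a * (pstar * m) - c0 <= V 0 by rewrite subKr.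
have := algorithm_profit_ge arrP Dp admX runX delta0 dm mU USbar p0 a0 L0 pd Vq
  c00 V0 th0 k0 drift' th'0 g0 mid low r0 q1P q2P.
apply: filterS => w; apply: le_trans.
apply: (le_trans (leeD2r _ (opt_le Sbar))).
rewrite -EFinN -EFinD lee_fin lerD2l lerN2 le_eqVlt; apply/orP; left; apply/eqP.
by rewrite -/m /delta /r; ring.
Qed.
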